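(* Let $\mathcal{X},\mathcal{Y}_1,\mathcal{Y}_2$ be finite sets and consider the binary hypothesis testing system described in the context, with null pmf $P_{XY_1Y_2}$ and alternative pmf $\bar P_{XY_1Y_2}$. If $\bar P_{XY_1Y_2}(x,y_1,y_2)>0$ for all $(x,y_1,y_2)\in\mathcal{X}\times\mathcal{Y}_1\times\mathcal{Y}_2$, then for any $\epsilon_1,\epsilon_2\in(0,1)$ the region $\mathcal{E}(0,0,\epsilon_1,\epsilon_2)$ equals the set of all nonnegative pairs $(\theta_1,\theta_2)$ with \[\theta_1\le\min_{\tilde P_{XY_1}:\ \tilde P_X=P_X,\ \tilde P_{Y_1}=P_{Y_1}} D(\tilde P_{XY_1}\|\bar P_{XY_1}),\] \[\theta_2\le\min_{\tilde P_{XY_1Y_2}:\ \tilde P_X=P_X,\ \tilde P_{Y_1}=P_{Y_1},\ \tilde P_{Y_2}=P_{Y_2}} D(\tilde P_{XY_1Y_2}\|\bar P_{XY_1Y_2}),\] where the minima range over pmfs on $\mathcal{X}\times\mathcal{Y}_1$ resp. $\mathcal{X}\times\mathcal{Y}_1\times\mathcal{Y}_2$ with the indicated marginals.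
   Context: Setting: Under hypothesis $\mathcal{H}=1$ (null) the triples $(X_t,Y_{1,t},Y_{2,t})$, $t=1,\dots,n$, are i.i.d. $\sim P_{XY_1Y_2}$; under $\mathcal{H}=2$ (alternative) i.i.d. $\sim \bar P_{XY_1Y_2}$. $P_X,P_{Y_1},P_{Y_2}$, $\bar P_{XY_1}$ denote marginals. A code of blocklength $n$: encoder $\phi_{1,n}:\mathcal{X}^n\to\{1,\dots,\|\phi_{1,n}\|\}$, $M_1=\phi_{1,n}(X^n)$ sent to both detectors; Detector 1 (observing $Y_1^n$) computes $M_2=\phi_{2,n}(M_1,Y_1^n)\in\{1,\dots,\|\phi_{2,n}\|\}$, sent to Detector 2, and decides $\hat{\mathcal H}_1=\psi_{1,n}(M_1,Y_1^n)\in\{1,2\}$; Detector 2 (observing $Y_2^n$) decides $\hat{\mathcal H}_2=\psi_{2,n}(M_1,M_2,Y_2^n)\in\{1,2\}$. Let $\alpha_{k,n}=\Pr[\hat{\mathcal H}_k\neq 1\mid\mathcal H=1]$, $\beta_{k,n}=\Pr[\hat{\mathcal H}_k\neq 2\mid\mathcal H=2]$. $(\theta_1,\theta_2)$ is achievable for $(R_1,R_2,\epsilon_1,\epsilon_2)$ if there are codes for all $n$ with $\limsup_n\alpha_{k,n}\le\epsilon_k$, $\theta_k\le\liminf_n-\frac1n\log\beta_{k,n}$, $\limsup_n\frac1n\log\|\phi_{k,n}\|\le R_k$, $k=1,2$. $\mathcal{E}(R_1,R_2,\epsilon_1,\epsilon_2)$ is the closure of the set of achievable pairs; here $R_1=R_2=0$.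 *)

(* Defs.v *)
From HB Require Import structures.
From mathcomp Require Import all_boot all_order all_algebra.
From mathcomp Require Import all_classical all_reals all_analysis.
Set Implicit Arguments. Unset Strict Implicit. Unset Printing Implicit Defensive.
Import Order.TTheory GRing.Theory Num.Theory.
Local Open Scope ring_scope.
Local Open Scope classical_set_scope.

Section HT.
Variable R : realType.

Definition is_pmf (T : finType) (p : {ffun T -> R}) : Prop :=
  (forall t, 0 <= p t) /\ \sum_t p t = 1.

Definition push (T U : finType) (f : T -> U) (p : {ffun T -> R}) : {ffun U -> R} :=
  [ffun u => \sum_(t | f t == u) p t].

Definition KL (T : finType) (p q : {ffun T -> R}) : R :=
  \sum_t (if p t == 0 then 0 else p t * ln (p t / q t)).

Variables X Y1 Y2 : finType.
Notation T := ((X * Y1) * Y2)%type.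

Definition pX (t : T) : X := t.1.1.
Definition pY1 (t : T) : Y1 := t.1.2.
Definition pY2 (t : T) : Y2 := t.2.
Definition pXY1 (t : T) : X * Y1 := t.1.

Definition seqprob (n : nat) (P : {ffun T -> R}) (E : pred {ffun 'I_n -> T}) : R :=
  \sum_(s : {ffun 'I_n -> T} | E s) \prod_(i < n) P (s i).

Definition xs n (s : {ffun 'I_n -> T}) : {ffun 'I_n -> X} := [ffun i => pX (s i)].
Definition y1s n (s : {ffun 'I_n -> T}) : {ffun 'I_n -> Y1} := [ffun i => pY1 (s i)].
Definition y2s n (s : {ffun 'I_n -> T}) : {ffun 'I_n -> Y2} := [ffun i => pY2 (s i)].

(* A code of blocklength n.  Decisions: false = "H = 1", true = "H = 2". *)
Record code (n : nat) := Code {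
  size1 : nat;
  size2 : nat;
  phi1 : {ffun 'I_n -> X} -> 'I_size1;
  phi2 : 'I_size1 -> {ffun 'I_n -> Y1} -> 'I_size2;
  psi1 : 'I_size1 -> {ffun 'I_n -> Y1} -> bool;
  psi2 : 'I_size1 -> 'I_size2 -> {ffun 'I_n -> Y2} -> bool }.

Definition dec1 n (c : code n) (s : {ffun 'I_n -> T}) : bool :=
  @psi1 _ c (@phi1 _ c (xs s)) (y1s s).
Definition dec2 n (c : code n) (s : {ffun 'I_n -> T}) : bool :=
  let m1 := @phi1 _ c (xs s) in @psi2 _ c m1 (@phi2 _ c m1 (y1s s)) (y2s s).

Definition alpha1 n (P : {ffun T -> R}) (c : code n) := seqprob P (fun s => dec1 c s).
Definition alpha2 n (P : {ffun T -> R}) (c : code n) := seqprob P (fun s => dec2 c s).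
Definition beta1 n (Pb : {ffun T -> R}) (c : code n) := seqprob Pb (fun s => ~~ dec1 c s).
Definition beta2 n (Pb : {ffun T -> R}) (c : code n) := seqprob Pb (fun s => ~~ dec2 c s).

Definition limsup_le (a : nat -> R) (c : R) : Prop :=
  forall d : R, 0 < d -> exists N, forall n, (N <= n)%N -> a n <= c + d.

(* theta <= liminf_n -(1/n) ln (b n), unfolded without logarithms:
   eventually b n <= exp(-n (theta - d)) (also correct when b n = 0) *)
Definition exponent_ge (b : nat -> R) (theta : R) : Prop :=
  forall d : R, 0 < d -> exists N, forall n, (N <= n)%N ->
    b n <= expR (- (n%:R * (theta - d))).

(* limsup_n (1/n) ln (m n) <= r, unfolded without logarithms *)
Definition rate_le (m : nat -> nat) (r : R) : Prop :=
  forall d : R, 0 < d -> exists N, forall n, (N <= n)%N ->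
    (m n)%:R <= expR (n%:R * (r + d)).

Definition achievable (P Pb : {ffun T -> R}) (R1 R2 e1 e2 : R) : set (R * R) :=
  [set th | 0 <= th.1 /\ 0 <= th.2 /\
    exists c : forall n, code n,
      limsup_le (fun n => alpha1 P (c n)) e1 /\
      limsup_le (fun n => alpha2 P (c n)) e2 /\
      exponent_ge (fun n => beta1 Pb (c n)) th.1 /\
      exponent_ge (fun n => beta2 Pb (c n)) th.2 /\
      rate_le (fun n => size1 (c n)) R1 /\
      rate_le (fun n => size2 (c n)) R2].

Definition region (P Pb : {ffun T -> R}) (R1 R2 e1 e2 : R) : set (R * R) :=
  @closure (R^o * R^o)%type (achievable P Pb R1 R2 e1 e2).

Definition feas1 (P : {ffun T -> R}) : set {ffun (X * Y1)%type -> R} :=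
  [set q | is_pmf q /\ push fst q = push pX P /\ push snd q = push pY1 P].
Definition feas2 (P : {ffun T -> R}) : set {ffun T -> R} :=
  [set q | is_pmf q /\ push pX q = push pX P /\ push pY1 q = push pY1 P /\
           push pY2 q = push pY2 P].

Definition theta1_star (P Pb : {ffun T -> R}) : R :=
  inf [set KL q (push pXY1 Pb) | q in feas1 P].
Definition theta2_star (P Pb : {ffun T -> R}) : R :=
  inf [set KL q Pb | q in feas2 P].

End HT.

(* Main.v *)
(** Converse.  An acceptance region is a union of subexponentially many boxes
    [C x F x G], so one box has null probability at least [exp (- n d)], and so
    have [C], [F] and [G] under their own marginals.  For every [q] with the
    same marginals as [P] there is a reverse Hölder inequality
    [k (E_q u  E_q v  E_q w)^L <= E_Pb (u v w)^L] for nonnegative [u(x)], [v(y1)],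
    [w(y2)], where [- ln k] tends to [D(q || Pb)] as [L] grows (full support of
    [Pb] is used here).  It tensorizes, and applied to the indicators of [C],
    [F], [G] it bounds the alternative probability of the box from below for
    every [epsilon < 1]; no blowing-up lemma is needed.

    Achievability.  Each terminal forwards one bit telling whether all sequences
    so far are typical.  If the type [q] of the observed sequence has marginals
    with [(1 - tau) q_X <= P_X] etc., then [(1 - tau) q + tau r], for a product
    law [r], has exactly the marginals of [P]; by convexity its divergence exceeds
    that of [q] by [O(tau)], and the method of types concludes. *)
Require Import Defs.
From HB Require Import structures.
From mathcomp Require Import all_boot all_order all_algebra.
From mathcomp Require Import all_classical all_reals all_analysis.
From mathcomp Require Import ring lra.
Import Order.TTheory GRing.Theory Num.Theory.
Local Open Scope ring_scope.
Local Open Scope classical_set_scope.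

(** * Laws on finite sets and their images *)

Lemma is_pmf_push {R : realType} {T U : finType} (f : T -> U) (p : {ffun T -> R}) :
  is_pmf p -> is_pmf (push f p).
Proof.
move=> [p0 p1]; split=> [u|]; first by rewrite ffunE sumr_ge0.
under eq_bigr do rewrite ffunE.
by rewrite -p1 [RHS](partition_big f predT).
Qed.

Lemma sum_push {R : realType} {T U : finType} (f : T -> U) (p : {ffun T -> R})
    (F : U -> R) : \sum_u push f p u * F u = \sum_t p t * F (f t).
Proof.
rewrite [RHS](partition_big f predT) //=; apply: eq_bigr => u _.
rewrite ffunE big_distrl /=; apply: eq_bigr => t /eqP ft.
by rewrite ft.
Qed.

Lemma push_comp {R : realType} {T U V : finType} (f : T -> U) (g : U -> V)
    (p : {ffun T -> R}) : push (g \o f) p = push g (push f p).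
Proof.
apply/ffunP => v; rewrite !ffunE [LHS](partition_big f (fun u => g u == v)) //=.
apply: eq_bigr => u /eqP guv; rewrite ffunE; apply: eq_bigl => t.
by have [->|//] := eqVneq (f t) u; rewrite ?guv ?eqxx ?andbT ?andbF.
Qed.

Lemma pmf_inhabited {R : realType} {T : finType} {p : {ffun T -> R}} :
  is_pmf p -> exists t, 0 < p t.
Proof.
move=> [p0 p1]; apply: contrapT => np.
have : \sum_t p t = 0.
  apply: big1 => t _; apply/eqP; rewrite eq_le p0 andbT leNgt.
  by apply/negP => pt; apply: np; exists t.
by rewrite p1 => /eqP; rewrite oner_eq0.
Qed.

Lemma pmf_le1 {R : realType} {T : finType} {p : {ffun T -> R}} :
  is_pmf p -> forall t, p t <= 1.
Proof.
move=> [p0 <-] t; rewrite (bigD1 t) //= lerDl; exact: sumr_ge0.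
Qed.

Lemma pos_lower_bound {R : realType} {T : finType} {p : {ffun T -> R}} :
  (forall t, 0 < p t) -> exists2 c, 0 < c <= 1 & forall t, c <= p t.
Proof.
(* Starting the minimum at 1 gives [c <= 1], hence [ln c <= 0] when [tau] is chosen in the
   achievability part. *)
move=> p0; exists (\big[Num.min/1]_t p t); last by move=> t; exact: bigmin_le_cond.
rewrite bigmin_le_id andbT.
by elim/big_ind: _ => // x y x0 y0; rewrite lt_min x0.
Qed.

(** * Divergence and the Gibbs variational inequality *)

Lemma KLE {R : realType} {T : finType} (p q : {ffun T -> R}) :
  KL p q = \sum_t p t * ln (p t / q t).
Proof. by apply: eq_bigr => t _; case: eqP => [->|//]; rewrite !mul0r. Qed.

(** Donsker-Varadhan inequality: [ln x <= x - 1], applied to the ratio of the tilted law [q e^h / S]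
    to [p], gives it term by term. Taking [h = 0] yields nonnegativity of the divergence; the
    reverse Hölder inequality takes for [h] a sum of functions of single coordinates. *)
Lemma gibbs_variational {R : realType} {T : finType} (p q : {ffun T -> R}) (h : T -> R) :
  is_pmf p -> (forall t, 0 < q t) ->
  expR (\sum_t p t * h t - KL p q) <= \sum_t q t * expR (h t).
Proof.
move=> pmfp q0; have [t0 _] := pmf_inhabited pmfp; have [p0 p1] := pmfp.
set S := \sum_t q t * expR (h t).
have e0 t : 0 < q t * expR (h t) by rewrite mulr_gt0 ?expR_gt0.
have S0 : 0 < S.
  rewrite /S (bigD1 t0) //= ltr_pwDl // sumr_ge0 // => t _; exact: ltW.
rewrite -[leRHS]lnK ?posrE // ler_expR KLE.
suff : \sum_t p t * (h t - ln (p t / q t) - ln S) <= 0.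
  under eq_bigr do rewrite !mulrBr.
  by rewrite !sumrB -[X in _ - _ - X]big_distrl /= p1 mul1r subr_le0.
apply: (@le_trans _ _ (\sum_t (q t * expR (h t) / S - p t))); last first.
  by rewrite sumrB p1 -big_distrl /= divff ?subrr ?gt_eqF.
apply: ler_sum => t _; have := p0 t; rewrite le0r => /predU1P[->|pt].
  by rewrite mul0r subr0 divr_ge0 // ltW.
have -> : h t - ln (p t / q t) - ln S = ln (q t * expR (h t) / (p t * S)).
  rewrite !ln_div ?posrE ?mulr_gt0 ?expR_gt0 //.
  by rewrite !lnM ?posrE ?expR_gt0 // expRK; ring.
have x0 : 0 < q t * expR (h t) / (p t * S) by rewrite divr_gt0 ?e0 ?mulr_gt0.
have := @le_ln1Dx R (q t * expR (h t) / (p t * S) - 1).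
rewrite [1 + _]addrC subrK ltrBrDl subrr => /(_ x0) /(ler_wpM2l (ltW pt)) /le_trans -> //.
rewrite le_eqVlt; apply/orP; left; apply/eqP; field.
by rewrite !gt_eqF.
Qed.

Lemma KL_ge0 {R : realType} {T : finType} (p q : {ffun T -> R}) :
  is_pmf p -> is_pmf q -> (forall t, 0 < q t) -> 0 <= KL p q.
Proof.
move=> pmfp [_ q1] q0; have := gibbs_variational p q (fun=> 0) pmfp q0.
under eq_bigr do rewrite mulr0.
under [leRHS]eq_bigr do rewrite expR0 mulr1.
by rewrite big1 // q1 expR_le1 sub0r oppr_le0.
Qed.

(** * Means under product laws *)

(** Events are treated as means of indicators, which can be summed over messages, transported along
    coordinate maps and unrolled one letter at a time. *)
Definition iid_mean {R : realType} {T : finType} (p : {ffun T -> R}) (n : nat)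
    (F : {ffun 'I_n -> T} -> R) : R :=
  \sum_(s : {ffun 'I_n -> T}) (\prod_i p (s i)) * F s.

Definition map_seq {T U : finType} {n} (f : T -> U) (s : {ffun 'I_n -> T}) :
  {ffun 'I_n -> U} := [ffun i => f (s i)].

Definition cons_seq {T : finType} {n} (t : T) (s : {ffun 'I_n -> T}) :
  {ffun 'I_n.+1 -> T} := [ffun i => if unlift ord0 i is Some j then s j else t].

Lemma map_cons_seq {T U : finType} {n} (f : T -> U) t (s : {ffun 'I_n -> T}) :
  map_seq f (cons_seq t s) = cons_seq (f t) (map_seq f s).
Proof. by apply/ffunP => i; rewrite !ffunE; case: unliftP => // j _; rewrite ffunE. Qed.

Lemma seqprobE {R : realType} {X Y1 Y2 : finType} n (p : {ffun (X * Y1) * Y2 -> R})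
    (E : pred {ffun 'I_n -> (X * Y1) * Y2}) :
  seqprob p E = iid_mean p n (fun s => (E s)%:R).
Proof.
rewrite /seqprob big_mkcond; apply: eq_bigr => s _.
by case: (E s); rewrite ?mulr1 ?mulr0.
Qed.

Section IidMean.
Context {R : realType} {T : finType}.
Implicit Types p : {ffun T -> R}.

Lemma iid_mean0 p F (s0 : {ffun 'I_0 -> T}) : iid_mean p 0 F = F s0.
Proof.
rewrite /iid_mean (big_pred1 s0); first by rewrite big_ord0 mul1r.
by move=> s; apply/esym/eqP/ffunP => -[].
Qed.

Lemma iid_meanS p n F :
  iid_mean p n.+1 F = \sum_t p t * iid_mean p n (fun s => F (cons_seq t s)).
Proof.
rewrite /iid_mean; under [RHS]eq_bigr do rewrite big_distrr /=.
rewrite pair_bigA /=.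
rewrite (reindex (fun ts : T * {ffun 'I_n -> T} => cons_seq ts.1 ts.2)) /=; last first.
  exists (fun s : {ffun 'I_n.+1 -> T} => (s ord0, [ffun j => s (lift ord0 j)])) => [[t s] _|s _] /=.
    rewrite ffunE unlift_none; congr (_, _); apply/ffunP => j.
    by rewrite !ffunE liftK.
  by apply/ffunP => i; rewrite ffunE; case: unliftP => [j ->|->]; rewrite ?ffunE.
apply: eq_bigr => -[t s] _ /=; rewrite mulrA big_ord_recl; congr (_ * _ * _).
  by rewrite ffunE unlift_none.
by apply: eq_bigr => i _; rewrite ffunE liftK.
Qed.

Lemma eq_iid_mean p n F G : F =1 G -> iid_mean p n F = iid_mean p n G.
Proof. by move=> FG; apply: eq_bigr => s _; rewrite FG. Qed.

Lemma prod_pmf_ge0 p n (s : {ffun 'I_n -> T}) : is_pmf p -> 0 <= \prod_i p (s i).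
Proof. by move=> [p0 _]; exact: prodr_ge0. Qed.

Lemma ler_iid_mean p n F G : is_pmf p -> (forall s, F s <= G s) ->
  iid_mean p n F <= iid_mean p n G.
Proof.
by move=> pp FG; apply: ler_sum => s _; rewrite ler_wpM2l ?prod_pmf_ge0.
Qed.

Lemma iid_mean_ge0 p n F : is_pmf p -> (forall s, 0 <= F s) -> 0 <= iid_mean p n F.
Proof. by move=> pp F0; apply: sumr_ge0 => s _; rewrite mulr_ge0 ?prod_pmf_ge0. Qed.

Lemma iid_meanD p n F G :
  iid_mean p n (fun s => F s + G s) = iid_mean p n F + iid_mean p n G.
Proof. by rewrite /iid_mean -big_split; apply: eq_bigr => s _; rewrite mulrDr. Qed.

Lemma iid_mean_sum (I : finType) p n (F : I -> {ffun 'I_n -> T} -> R) :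
  iid_mean p n (fun s => \sum_i F i s) = \sum_i iid_mean p n (F i).
Proof. by rewrite /iid_mean exchange_big; apply: eq_bigr => s _; rewrite big_distrr. Qed.

Lemma iid_mean_prod p n (g : T -> R) :
  iid_mean p n (fun s => \prod_i g (s i)) = (\sum_t p t * g t) ^+ n.
Proof.
transitivity (\prod_(i < n) \sum_t p t * g t); last by rewrite prodr_const card_ord.
rewrite bigA_distr_bigA /=.
by apply: eq_bigr => s _; rewrite big_split.
Qed.

Lemma iid_mean1 p n : is_pmf p -> iid_mean p n (fun=> 1) = 1.
Proof.
move=> [_ p1]; rewrite (@eq_iid_mean _ _ _ (fun s => \prod_i (fun=> 1) (s i))).
  rewrite (iid_mean_prod p n (fun=> 1)); under eq_bigr do rewrite mulr1.
  by rewrite p1 expr1n.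
by move=> s; rewrite big1.
Qed.

Lemma iid_mean_indicator_le1 p n (E : pred {ffun 'I_n -> T}) : is_pmf p ->
  iid_mean p n (fun s => (E s)%:R) <= 1.
Proof.
move=> pp; apply: (@le_trans _ _ (iid_mean p n (fun=> 1))); last by rewrite iid_mean1.
by apply: ler_iid_mean => // s; case: (E s).
Qed.

End IidMean.

Lemma iid_mean_push {R : realType} {T U : finType} (f : T -> U) (p : {ffun T -> R}) n F :
  iid_mean (push f p) n F = iid_mean p n (F \o map_seq f).
Proof.
elim: n F => [|n IH] F.
  have s0 : {ffun 'I_0 -> T} by apply: finfun => -[].
  by rewrite (iid_mean0 _ _ (map_seq f s0)) (iid_mean0 _ _ s0).
rewrite !iid_meanS sum_push; apply: eq_bigr => t _; rewrite IH.
by congr (_ * _); apply: eq_iid_mean => s /=; rewrite map_cons_seq.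
Qed.

(** * Reverse Hölder inequality, for one letter and for blocks *)

(** The error must be uniform in [w]. With [a = exp (w - 1)] and [s = 1 - w], the difference of the
    powers is at most [(m + 1) (a - w) a^m]; here [a - w <= s^2], and the decay of
    [a^m = exp (- m s)] absorbs [s^2] up to [4 / m^2]. Then [4 (m + 1) / m^2 <= 8 / m]. *)
Lemma expR_le_power {R : realType} (m : nat) (w : R) : (0 < m)%N -> 0 <= w <= 1 ->
  expR (m.+1%:R * (w - 1)) <= w ^+ m.+1 + 8 / m%:R.
Proof.
move=> m0 /andP[w0 w1]; rewrite expRM_natl.
set a := expR (w - 1); set s := 1 - w.
have mR : 0 < m%:R :> R by rewrite ltr0n.
have s0 : 0 <= s by rewrite subr_ge0.
have a0 : 0 <= a := expR_ge0 _.
have wa : w <= a by have := expR_ge1Dx (w - 1); rewrite addrC subrK.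
have as1 : a * (1 + s) <= 1.
  rewrite [leRHS](_ : 1 = a * expR s); last by rewrite -expRD /s addrC subrKA subrr expR0.
  by rewrite ler_wpM2l // expR_ge1Dx.
have aw : a - w <= s ^+ 2 by rewrite /s in s0 as1 *; nra.
(* With [y = m s] this is [exp (- y) y^2 <= 4], the square of [exp (- y / 2) y <= 2], which follows
   from [1 + y / 2 <= exp (y / 2)]. *)
have am : a ^+ m * (m%:R * s) ^+ 2 <= 4.
  have b1 : expR (- (m%:R * s / 2)) * (1 + m%:R * s / 2) <= 1.
    rewrite [leRHS](_ : 1 = expR (- (m%:R * s / 2)) * expR (m%:R * s / 2)); last first.
      by rewrite -expRD addrC subrr expR0.
    by rewrite ler_wpM2l ?expR_ge0 // expR_ge1Dx.
  have -> : a ^+ m = expR (- (m%:R * s / 2)) ^+ 2.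
    by rewrite -!expRM_natl; congr expR; rewrite /s; field.
  set b := expR _ in b1 *; have b0 : 0 <= b := expR_ge0 _.
  have ms0 : 0 <= m%:R * s by rewrite mulr_ge0 // ltW.
  set y := m%:R * s in b1 ms0 *.
  have by0 : 0 <= b * y by exact: mulr_ge0.
  have by2 : b * y <= 2 by lra.
  rewrite -exprMn; nra.
rewrite -lerBlDl subrXX.
have S : \sum_(i < m.+1) a ^+ (m.+1.-1 - i) * w ^+ i <= m.+1%:R * a ^+ m.
  rewrite -[in leRHS](card_ord m.+1) mulr_natl -sumr_const; apply: ler_sum => i _.
  rewrite -[X in _ <= _ ^+ X](@subnK i) /=; last by rewrite -ltnS.
  by rewrite exprD ler_wpM2l ?exprn_ge0 // lerXn2r ?nnegrE.
apply: le_trans (ler_wpM2l _ S) _; first by rewrite subr_ge0.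
rewrite ler_pdivlMr //.
have m2 : m.+1%:R <= 2 * m%:R :> R.
  by rewrite -natrM ler_nat mul2n -addnn -addn1 leq_add2l.
have am0 : 0 <= a ^+ m by exact: exprn_ge0.
have awm : (a - w) * a ^+ m <= s ^+ 2 * a ^+ m by rewrite ler_wpM2r.
have aw0 : 0 <= (a - w) * a ^+ m by rewrite mulr_ge0 // subr_ge0.
set z := a ^+ m in am am0 awm aw0 *.
have -> : (a - w) * (m.+1%:R * z) * m%:R = m.+1%:R * (((a - w) * z) * m%:R) by ring.
apply: (@le_trans _ _ (2 * m%:R * (((a - w) * z) * m%:R))).
  by rewrite ler_wpM2r // mulr_ge0 // ltW.
apply: (@le_trans _ _ (2 * m%:R * ((s ^+ 2 * z) * m%:R))).
  by rewrite ler_wpM2l ?ler_wpM2r // ?mulr_ge0 // ltW.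
rewrite exprMn in am; set mm : R := m%:R in am *; nra.
Qed.

(** From [x <= exp (x - 1)]. The exponent on the right is linear in [q], so the bounds for the three
    coordinates multiply into the exponential of one mean under the joint law, whatever the
    dependence between coordinates. *)
Lemma mean_expn_le_expR {R : realType} {T : finType} (q : {ffun T -> R}) (a : T -> R) L :
  is_pmf q -> (forall t, 0 <= a t) ->
  (\sum_t q t * a t) ^+ L <= expR (\sum_t q t * (L%:R * (a t - 1))).
Proof.
move=> [q0 q1] a0.
have -> : \sum_t q t * (L%:R * (a t - 1)) = L%:R * (\sum_t q t * a t - 1).
  rewrite -[X in _ - X]q1 -sumrB big_distrr; apply: eq_bigr => t _ /=; ring.
rewrite expRM_natl lerXn2r ?nnegrE ?expR_ge0 ?sumr_ge0 // => [t _|].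
  exact: mulr_ge0.
have := expR_ge1Dx (\sum_t q t * a t - 1); by rewrite addrC subrK.
Qed.

Lemma exists_argmax {R : realType} {T : finType} (u : T -> R) : T ->
  exists x0, forall x, u x <= u x0.
Proof.
by move=> t; case: (@arg_maxP _ _ T t predT u) => // x0 _ h; exists x0 => x; exact: h.
Qed.

Lemma shift_prod3_le {R : realType} (a b r d : R) :
  0 <= a <= 1 -> 0 <= b <= 1 -> 0 <= r <= 1 -> 0 <= d <= 8 ->
  (a + d) * (b + d) * (r + d) <= a * b * r + 91 * d.
Proof.
move=> /andP[a0 a1] /andP[b0 b1] /andP[r0 r1] /andP[d0 d8].
have ab1 : a * b <= 1 by rewrite mulr_ile1.
have br1 : b * r <= 1 by rewrite mulr_ile1.
have ar1 : a * r <= 1 by rewrite mulr_ile1.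
have dd : d * d <= 8 * 8 by apply: ler_pM.
have ds : d * (a + b + r) <= 8 * 3 by apply: ler_pM; rewrite ?addr_ge0 //; lra.
(* The bounds [3], [8 * 3] and [8 * 8] add up to 91. *)
have E3 : a * b + b * r + a * r + d * (a + b + r) + d * d <= 91 by lra.
have := ler_wpM2l d0 E3; lra.
Qed.

(* In [reverse_holder_normalized] each of the three factors grows by [8 / m]
   (from [expR_le_power]), which changes a product of numbers of [0, 1] by at
   most [91 * (8 / m)] (from [shift_prod3_le]); hence 728. *)
Definition box_rate {R : realType} {T : finType} (q p : {ffun T -> R}) (c : R) (m : nat) : R :=
  expR (- KL q p) / (1 + 728 / (m%:R * c)).

Lemma box_rate_den_gt0 {R : realType} (c : R) m : 0 < c -> 0 < 1 + 728 / (m%:R * c).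
Proof.
move=> c0; apply: ltr_pwDl; first exact: ltr01.
apply: divr_ge0; first exact: ler0n.
by apply: mulr_ge0; [exact: ler0n | exact: ltW].
Qed.

Lemma box_rate_gt0 {R : realType} {T : finType} (q p : {ffun T -> R}) (c : R) m :
  0 < c -> 0 < box_rate q p c m.
Proof. by move=> c0; apply: divr_gt0; [exact: expR_gt0 | exact: box_rate_den_gt0]. Qed.

Lemma le_box_rate {R : realType} {T : finType} (q p : {ffun T -> R}) (c : R) m :
  0 < c -> - ln (box_rate q p c m) <= KL q p + (728 / c) / m%:R.
Proof.
move=> c0; have D0 := box_rate_den_gt0 c m c0.
rewrite /box_rate ln_div ?posrE ?expR_gt0 // expRK opprB opprK addrC lerD2l.
have -> : 728 / c / m%:R = 728 / (m%:R * c) by rewrite -mulrA -invfM [c * _]mulrC.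
apply/le_ln1Dx/(lt_le_trans (ltrN10 R)); apply: divr_ge0; first exact: ler0n.
by apply: mulr_ge0; [exact: ler0n | exact: ltW].
Qed.

Section ReverseHolder.
Context {R : realType} {X Y1 Y2 : finType}.
Notation T := ((X * Y1) * Y2)%type.
Variables (q Pb : {ffun T -> R}) (c : R) (m : nat).
Hypotheses (pmfq : is_pmf q) (pmfPb : is_pmf Pb) (c0 : 0 < c) (cPb : forall t, c <= Pb t).
Hypothesis m0 : (0 < m)%N.

Let L := m.+1.
Let factor : R := 1 + 728 / (m%:R * c).

Let factor_gt0 : 0 < factor := box_rate_den_gt0 c m c0.

(* After the maxima are normalized to 1, full support gives [c <= M], so the
   additive error of [expR_le_power] is also a multiplicative one; the terms
   [expR (L * (u - 1))] are then handled by [gibbs_variational]. *)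
Lemma reverse_holder_normalized (u : X -> R) (v : Y1 -> R) (w : Y2 -> R) x0 y0 z0 :
  (forall x, 0 <= u x <= 1) -> (forall y, 0 <= v y <= 1) -> (forall z, 0 <= w z <= 1) ->
  u x0 = 1 -> v y0 = 1 -> w z0 = 1 ->
  expR (- KL q Pb) * ((\sum_t q t * u (pX t)) * (\sum_t q t * v (pY1 t)) *
    (\sum_t q t * w (pY2 t))) ^+ L <=
  factor * \sum_t Pb t * (u (pX t) * v (pY1 t) * w (pY2 t)) ^+ L.
Proof.
move=> hu hv hw u1 v1 w1.
have mR : 0 < m%:R :> R by rewrite ltr0n.
have [Pb0 Pb1] := pmfPb.
have u0 x : 0 <= u x by case/andP: (hu x).
have v0 x : 0 <= v x by case/andP: (hv x).
have w0 x : 0 <= w x by case/andP: (hw x).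
set M := \sum_t Pb t * _.
have cM : c <= M.
  rewrite /M (bigD1 ((x0, y0), z0)) //= /pX /pY1 /pY2 /= u1 v1 w1 !mulr1 expr1n mulr1.
  rewrite -[c]addr0 lerD // sumr_ge0 // => t _.
  by rewrite mulr_ge0 // exprn_ge0 // !mulr_ge0.
pose e (x : R) : R := L%:R * (x - 1).
pose h t := e (u (pX t)) + e (v (pY1 t)) + e (w (pY2 t)).
apply: (@le_trans _ _ (expR (\sum_t q t * h t - KL q Pb))).
  rewrite addrC expRD ler_wpM2l ?expR_ge0 //.
  have -> : \sum_t q t * h t = \sum_t q t * e (u (pX t)) + \sum_t q t * e (v (pY1 t)) +
      \sum_t q t * e (w (pY2 t)).
    by rewrite -!big_split; apply: eq_bigr => t _; rewrite /= !mulrDr.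
  have q0 := pmfq.1.
  have Eu : 0 <= \sum_t q t * u (pX t) by apply: sumr_ge0 => t _; exact: mulr_ge0.
  have Ev : 0 <= \sum_t q t * v (pY1 t) by apply: sumr_ge0 => t _; exact: mulr_ge0.
  have Ew : 0 <= \sum_t q t * w (pY2 t) by apply: sumr_ge0 => t _; exact: mulr_ge0.
  rewrite !expRD !exprMn; apply: ler_pM; rewrite ?mulr_ge0 ?exprn_ge0 //.
    by apply: ler_pM; rewrite ?exprn_ge0 // mean_expn_le_expR.
  by rewrite mean_expn_le_expR.
have Pbpos t : 0 < Pb t by exact: lt_le_trans (cPb t).
apply: le_trans (gibbs_variational _ _ _ pmfq Pbpos) _.
set d : R := 8 / m%:R.
have d0 : 0 <= d by rewrite divr_ge0 // ltW.
have d8 : d <= 8 by rewrite ler_pdivrMr // ler_peMr // ler1n.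
apply: (@le_trans _ _ (M + 91 * d)); last first.
  apply: (@le_trans _ _ (M + 91 * d / c * M)).
    rewrite lerD2l mulrAC ler_pdivlMr // ler_wpM2l // mulr_ge0 //.
  rewrite le_eqVlt; apply/orP; left; apply/eqP; rewrite /factor /d; field.
  by rewrite !gt_eqF.
have -> : 91 * d = \sum_t Pb t * (91 * d) by rewrite -big_distrl /= Pb1 mul1r.
rewrite /M -big_split /=; apply: ler_sum => t _.
rewrite -mulrDr ler_wpM2l // /h !expRD.
apply: (@le_trans _ _ ((u (pX t) ^+ L + d) * (v (pY1 t) ^+ L + d) * (w (pY2 t) ^+ L + d))).
  apply: ler_pM; rewrite ?mulr_ge0 ?expR_ge0 //; last exact: expR_le_power.
  apply: ler_pM; rewrite ?expR_ge0 //; exact: expR_le_power.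
rewrite !exprMn.
have U := exprn_ge0 L (u0 (pX t)); have V := exprn_ge0 L (v0 (pY1 t)).
have W := exprn_ge0 L (w0 (pY2 t)).
have U1 : u (pX t) ^+ L <= 1 by have /andP[? ?] := hu (pX t); rewrite exprn_ile1.
have V1 : v (pY1 t) ^+ L <= 1 by have /andP[? ?] := hv (pY1 t); rewrite exprn_ile1.
have W1 : w (pY2 t) ^+ L <= 1 by have /andP[? ?] := hw (pY2 t); rewrite exprn_ile1.
by apply: shift_prod3_le; rewrite ?U ?V ?W ?d0.
Qed.

(** Both sides are homogeneous of degree [L] in each of [u], [v], [w], so the maxima can be scaled
    to 1. A function whose maximum is 0 vanishes and makes the left side 0. *)
Lemma reverse_holder (u : X -> R) (v : Y1 -> R) (w : Y2 -> R) :
  (forall x, 0 <= u x) -> (forall y, 0 <= v y) -> (forall z, 0 <= w z) ->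
  expR (- KL q Pb) * ((\sum_t q t * u (pX t)) * (\sum_t q t * v (pY1 t)) *
    (\sum_t q t * w (pY2 t))) ^+ L <=
  factor * \sum_t Pb t * (u (pX t) * v (pY1 t) * w (pY2 t)) ^+ L.
Proof.
move=> u0 v0 w0; have [t0 _] := pmf_inhabited pmfq.
have [x0 hx] := exists_argmax u (pX t0); have [y0 hy] := exists_argmax v (pY1 t0).
have [z0 hz] := exists_argmax w (pY2 t0).
have fac0 := ltW factor_gt0.
have rhs0 : 0 <= factor * \sum_t Pb t * (u (pX t) * v (pY1 t) * w (pY2 t)) ^+ L.
  rewrite mulr_ge0 // sumr_ge0 // => t _.
  by rewrite mulr_ge0 ?(pmfPb.1) // exprn_ge0 // !mulr_ge0.
have deg (U : finType) (f : U -> R) (p : T -> U) k : (forall x, 0 <= f x) ->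
    (forall x, f x <= f k) -> f k = 0 -> \sum_t q t * f (p t) = 0.
  move=> f0 fk k0; apply: big1 => t _.
  by have /eqP -> : f (p t) == 0; rewrite ?mulr0 // eq_le f0 -k0 fk.
have [ux|ux] := eqVneq (u x0) 0.
  by rewrite (deg _ _ _ _ u0 hx ux) !mul0r expr0n mulr0.
have [vy|vy] := eqVneq (v y0) 0.
  by rewrite (deg _ _ _ _ v0 hy vy) mulr0 !mul0r expr0n mulr0.
have [wz|wz] := eqVneq (w z0) 0.
  by rewrite (deg _ _ _ _ w0 hz wz) !mulr0 expr0n mulr0.
have ux0 : 0 < u x0 by rewrite lt_def ux u0.
have vy0 : 0 < v y0 by rewrite lt_def vy v0.
have wz0 : 0 < w z0 by rewrite lt_def wz w0.
have nrm (U : finType) (f : U -> R) k : (forall x, 0 <= f x) -> (forall x, f x <= f k) ->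
    0 < f k -> forall x, 0 <= f x / f k <= 1.
  by move=> f0 fk k0 x; rewrite divr_ge0 ?(ltW k0) //= ler_pdivrMr // mul1r.
have := reverse_holder_normalized (fun x => u x / u x0) (fun y => v y / v y0)
  (fun z => w z / w z0) x0 y0 z0 (nrm _ _ _ u0 hx ux0) (nrm _ _ _ v0 hy vy0)
  (nrm _ _ _ w0 hz wz0) (divff ux) (divff vy) (divff wz).
pose S := (u x0 * v y0 * w z0) ^+ L.
have S0 : 0 < S by rewrite exprn_gt0 // !mulr_gt0.
move=> /(ler_wpM2l (ltW S0)) H.
have pull (U : finType) (f : U -> R) (p : T -> U) k : f k != 0 ->
    \sum_t q t * f (p t) = f k * \sum_t q t * (f (p t) / f k).
  by move=> fk; rewrite big_distrr; apply: eq_bigr => t _ /=; field.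
rewrite (pull _ u (@pX _ _ _) _ ux) (pull _ v (@pY1 _ _ _) _ vy) (pull _ w (@pY2 _ _ _) _ wz).
apply: le_trans (le_trans H _); rewrite le_eqVlt; apply/orP; left; apply/eqP.
  rewrite [RHS]mulrCA /S -exprMn; congr (_ * _ ^+ _); ring.
rewrite [LHS]mulrCA; congr (_ * _); rewrite big_distrr; apply: eq_bigr => t _ /=.
rewrite [LHS]mulrCA /S -exprMn; congr (_ * _ ^+ _); field.
by rewrite wz vy.
Qed.

(** Tensorization by induction on [n]: the one-letter inequality is applied to the averages [u'],
    [v'], [w'] over the last [n] letters, and for each value of the first letter the induction
    hypothesis bounds the [L]-th power of their product. *)
Lemma iid_reverse_holder n (u : {ffun 'I_n -> X} -> R) (v : {ffun 'I_n -> Y1} -> R)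
    (w : {ffun 'I_n -> Y2} -> R) :
  (forall x, 0 <= u x) -> (forall y, 0 <= v y) -> (forall z, 0 <= w z) ->
  (expR (- KL q Pb) / factor) ^+ n * (iid_mean q n (fun s => u (map_seq (@pX X Y1 Y2) s)) *
     iid_mean q n (fun s => v (map_seq (@pY1 X Y1 Y2) s)) *
     iid_mean q n (fun s => w (map_seq (@pY2 X Y1 Y2) s))) ^+ L <=
  iid_mean Pb n (fun s => (u (map_seq (@pX X Y1 Y2) s) * v (map_seq (@pY1 X Y1 Y2) s) *
     w (map_seq (@pY2 X Y1 Y2) s)) ^+ L).
Proof.
elim: n u v w => [|n IH] u v w u0 v0 w0.
  have s0 : {ffun 'I_0 -> T} by apply: finfun => -[].
  by rewrite !(iid_mean0 _ _ s0) mul1r.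
have fac0 := factor_gt0.
set k := expR _ / factor; have k0 : 0 <= k by rewrite divr_ge0 ?expR_ge0 // ltW.
pose u' x := iid_mean q n (fun s => u (cons_seq x (map_seq (@pX X Y1 Y2) s))).
pose v' x := iid_mean q n (fun s => v (cons_seq x (map_seq (@pY1 X Y1 Y2) s))).
pose w' x := iid_mean q n (fun s => w (cons_seq x (map_seq (@pY2 X Y1 Y2) s))).
have u'0 x : 0 <= u' x by apply: iid_mean_ge0.
have v'0 x : 0 <= v' x by apply: iid_mean_ge0.
have w'0 x : 0 <= w' x by apply: iid_mean_ge0.
rewrite !iid_meanS.
have step (F : T -> R) (G : T -> {ffun 'I_n -> T} -> R) (g : T -> R) :
    (forall t, g t = iid_mean q n (G t)) -> \sum_t F t * iid_mean q n (G t) = \sum_t F t * g t.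
  by move=> gG; apply: eq_bigr => t _; rewrite gG.
rewrite (step _ _ (fun t => u' (pX t))); last first.
  by move=> t; apply: eq_iid_mean => s; rewrite map_cons_seq.
rewrite (step _ _ (fun t => v' (pY1 t))); last first.
  by move=> t; apply: eq_iid_mean => s; rewrite map_cons_seq.
rewrite (step _ _ (fun t => w' (pY2 t))); last first.
  by move=> t; apply: eq_iid_mean => s; rewrite map_cons_seq.
rewrite exprSr -mulrA.
apply: (@le_trans _ _ (k ^+ n * \sum_t Pb t * (u' (pX t) * v' (pY1 t) * w' (pY2 t)) ^+ L)).
  rewrite ler_wpM2l ?exprn_ge0 // /k mulrAC ler_pdivrMr // [leRHS]mulrC.
  exact: reverse_holder.
rewrite big_distrr; apply: ler_sum => t _ /=.
rewrite mulrCA ler_wpM2l ?(pmfPb.1) //.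
apply: le_trans (IH (fun s => u (cons_seq (pX t) s)) (fun s => v (cons_seq (pY1 t) s))
  (fun s => w (cons_seq (pY2 t) s)) _ _ _) _ => //.
rewrite le_eqVlt; apply/orP; left; apply/eqP; apply: eq_iid_mean => s.
by rewrite !map_cons_seq.
Qed.

(** Indicators equal their own [L]-th powers, so the power disappears on the right. On the left it
    costs nothing in the exponent as long as the three probabilities are not exponentially small. *)
Lemma iid_box_lower_bound n (C : pred {ffun 'I_n -> X}) (F : pred {ffun 'I_n -> Y1})
    (G : pred {ffun 'I_n -> Y2}) :
  box_rate q Pb c m ^+ n * (iid_mean q n (fun s => (C (xs s))%:R) *
     iid_mean q n (fun s => (F (y1s s))%:R) *
     iid_mean q n (fun s => (G (y2s s))%:R)) ^+ L <=
  iid_mean Pb n (fun s => ([&& C (xs s), F (y1s s) & G (y2s s)])%:R).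
Proof.
have := iid_reverse_holder n (fun s => (C s)%:R) (fun s => (F s)%:R) (fun s => (G s)%:R).
move=> /(_ (fun _ => ler0n _ _) (fun _ => ler0n _ _) (fun _ => ler0n _ _)) /le_trans; apply.
rewrite le_eqVlt; apply/orP; left; apply/eqP; apply: eq_iid_mean => s.
rewrite -/(xs s) -/(y1s s) -/(y2s s).
by case: (C _); case: (F _); case: (G _); rewrite ?mulr1 ?mulr0 ?mul0r ?expr1n ?expr0n.
Qed.

End ReverseHolder.

(** * Converse *)

Lemma pigeonhole {R : realType} {I : finType} (f : I -> R) (i0 : I) :
  exists i, (\sum_j f j) / #|I|%:R <= f i.
Proof.
have [i hi] := exists_argmax f i0; exists i.
have I0 : (0 < #|I|)%N by apply/card_gt0P; exists i0.
rewrite ler_pdivrMr ?ltr0n // mulr_natr -sumr_const; exact: ler_sum.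
Qed.

(** With [a] and [r] fixed and [sz] of rate zero, the factor [(a / sz n) ^ r] is subexponential, so
    only [k ^ n] matters for the exponent. *)
Lemma exponent_upper_bound {R : realType} (b : nat -> R) (sz : nat -> nat) (a k th : R)
    (r : nat) : 0 < a -> 0 < k -> (forall n, (0 < sz n)%N) ->
  @rate_le R sz 0 -> exponent_ge b th ->
  (exists N, forall n, (N <= n)%N -> k ^+ n * (a / (sz n)%:R) ^+ r <= b n) ->
  th <= - ln k.
Proof.
move=> a0 k0 sz0 hsz hb [N0 hk]; rewrite leNgt; apply/negP => lt_th.
pose d := th + ln k; have d0 : 0 < d by rewrite /d -ltrBlDr sub0r.
(* One [e] is lost in the exponent of [b] and [r] more in the sizes, in all [d / 2]; the remaining
   [n d / 2] exceeds the constant [B] once [n > 2 B / d]. *)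
pose e : R := d / 2 / r.+1%:R; have e0 : 0 < e by rewrite !divr_gt0 // ltr0n.
have [N1 h1] := hsz e e0; have [N2 h2] := hb e e0.
pose B := r%:R * (- ln a).
pose n := maxn (maxn N0 N1) (maxn N2 (Num.bound `|2 * B / d|).+1).
have n0 : (N0 <= n)%N by rewrite !leq_max leqnn.
have n1 : (N1 <= n)%N by rewrite !leq_max leqnn orbT.
have n2 : (N2 <= n)%N by rewrite !leq_max leqnn !orbT.
have n3 : 2 * B / d < n%:R.
  apply: le_lt_trans (ler_norm _) _; apply: lt_le_trans (archi_boundP (normr_ge0 _)) _.

  rewrite ler_nat !leq_max; apply/orP; right; apply/orP; right; exact: leqnSn.
have szn : 0 < (sz n)%:R :> R by rewrite ltr0n.
have H : k ^+ n * (a / expR (n%:R * e)) ^+ r <= expR (- (n%:R * (th - e))).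
  apply: le_trans (h2 n n2); apply: le_trans (hk n n0).
  rewrite ler_wpM2l ?exprn_ge0 ?(ltW k0) //.
  rewrite lerXn2r ?nnegrE ?divr_ge0 ?expR_ge0 ?(ltW a0) ?(ltW szn) //.
  by rewrite ler_wpM2l ?(ltW a0) // lef_pV2 ?posrE ?expR_gt0 // -[e]add0r h1.
move: H; rewrite -{1}[k]lnK ?posrE // -[a]lnK ?posrE // -expRM_natl.
rewrite -expRB -expRM_natl -expRD ler_expR.
have er : e * r.+1%:R = d / 2 by rewrite /e mulfVK // pnatr_eq0.
have E2 : n%:R * (e * r.+1%:R) = n%:R * (d / 2) by rewrite er.
have ED : n%:R * d = n%:R * th + n%:R * ln k by rewrite /d mulrDr.
move: n3; rewrite ltr_pdivrMr // /B -natr1 in E2 * => n3 H; lra.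
Qed.

Lemma rate_le_mul {R : realType} (m1 m2 : nat -> nat) :
  @rate_le R m1 0 -> @rate_le R m2 0 -> @rate_le R (fun n => m1 n * m2 n)%N 0.
Proof.
move=> h1 h2 d d0; have d20 : 0 < d / 2 by rewrite divr_gt0.
have [N1 g1] := h1 _ d20; have [N2 g2] := h2 _ d20.
exists (maxn N1 N2) => n; rewrite geq_max => /andP[n1 n2].
rewrite natrM; apply: le_trans (ler_pM _ _ (g1 n n1) (g2 n n2)) _ => //.
by rewrite -expRD -mulrDr !add0r -splitr.
Qed.

Lemma le_of_le_add_div {R : realType} (x y C : R) :
  0 <= C -> (forall m, (0 < m)%N -> x <= y + C / m%:R) -> x <= y.
Proof.
move=> C0 h; apply/ler_addgt0Pr => e e0.
have := h (Num.bound `|C / e|).+1 isT; move=> /le_trans; apply.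
rewrite lerD2l ler_pdivrMr ?ltr0n // mulrC -ler_pdivrMr //.
apply: le_trans (ler_norm _) _; apply: le_trans (ltW (archi_boundP (normr_ge0 _))) _.
by rewrite ler_nat.
Qed.

(** This exchanges [P] for a feasible [q]: an event seen by a single terminal depends only on the
    marginal that the two laws share. *)
Lemma iid_mean_eq_push {R : realType} {T U : finType} (f : T -> U) (p q : {ffun T -> R}) n
    (F : {ffun 'I_n -> U} -> R) : push f p = push f q ->
  iid_mean p n (fun s => F (map_seq f s)) = iid_mean q n (fun s => F (map_seq f s)).
Proof. by move=> pq; rewrite -[LHS](iid_mean_push f p) pq iid_mean_push. Qed.

Section Converse.
Context {R : realType} {X Y1 Y2 : finType}.
Notation T := ((X * Y1) * Y2)%type.
Variables (P Pb : {ffun T -> R}).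
Hypotheses (pmfP : is_pmf P) (pmfPb : is_pmf Pb) (Pb0 : forall t, 0 < Pb t).

(** The message pairs cut the acceptance region into disjoint sets. Each is a box: once [m1] and
    [m2] are fixed, the three conditions bear on the [X], [Y1] and [Y2] sequences separately. *)
Lemma code_accept2 n (c : Defs.code X Y1 Y2 n) (s : {ffun 'I_n -> T}) :
  \sum_(m : 'I_(size1 c) * 'I_(size2 c))
    ([&& phi1 c (xs s) == m.1, phi2 m.1 (y1s s) == m.2 & ~~ psi2 m.1 m.2 (y2s s)])%:R
  = (~~ dec2 c s)%:R :> R.
Proof.
rewrite (bigD1 (phi1 c (xs s), phi2 (phi1 c (xs s)) (y1s s))) //= !eqxx /=.
rewrite big1 ?addr0 // => -[m1 m2] /=; have [<-|//] := eqVneq (phi1 c (xs s)) m1.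
by have [<-|//] := eqVneq (phi2 _ (y1s s)) m2; move=> /eqP [].
Qed.

Lemma code_accept1 n (c : Defs.code X Y1 Y2 n) (s : {ffun 'I_n -> T}) :
  \sum_(m : 'I_(size1 c)) ([&& phi1 c (xs s) == m, ~~ psi1 m (y1s s) & true])%:R
  = (~~ dec1 c s)%:R :> R.
Proof.
rewrite (bigD1 (phi1 c (xs s))) //= !eqxx /= andbT.
rewrite big1 ?addr0 // => m; by have [<-|//] := eqVneq (phi1 c (xs s)) m; move=> /eqP [].
Qed.

Lemma accept_prob2 n (c : Defs.code X Y1 Y2 n) :
  1 - alpha2 P c = iid_mean P n (fun s => (~~ dec2 c s)%:R).
Proof.
rewrite /alpha2 seqprobE; apply/eqP; rewrite subr_eq -iid_meanD eq_sym; apply/eqP.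
rewrite -[RHS](iid_mean1 P n pmfP); apply: eq_iid_mean => s.
by case: dec2; rewrite ?addr0 ?add0r.
Qed.

Lemma accept_prob1 n (c : Defs.code X Y1 Y2 n) :
  1 - alpha1 P c = iid_mean P n (fun s => (~~ dec1 c s)%:R).
Proof.
rewrite /alpha1 seqprobE; apply/eqP; rewrite subr_eq -iid_meanD eq_sym; apply/eqP.
rewrite -[RHS](iid_mean1 P n pmfP); apply: eq_iid_mean => s.
by case: dec1; rewrite ?addr0 ?add0r.
Qed.

Variables (b : R) (m : nat).
Hypotheses (b0 : 0 < b) (bPb : forall t, b <= Pb t) (m0 : (0 < m)%N).

(** The likeliest box has null probability at least the average over message pairs. Each of its
    three sides contains it, so is at least as likely under [P], and equally likely under [q]. Three
    factors to the power [m + 1] give the exponent. *)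
Lemma beta2_lower_bound (q : {ffun T -> R}) n (c : Defs.code X Y1 Y2 n) :
  feas2 P q ->
  box_rate q Pb b m ^+ n * ((1 - alpha2 P c) / (size1 c * size2 c)%:R) ^+ (3 * m.+1) <= beta2 Pb c.
Proof.
move=> [pmfq [qX [qY1 qY2]]]; have [t0 _] := pmf_inhabited pmfP.
pose x0 := phi1 c (xs [ffun=> t0]); pose z0 := phi2 x0 (y1s [ffun=> t0]).
pose box (m : 'I_(size1 c) * 'I_(size2 c)) (s : {ffun 'I_n -> T}) :=
  [&& phi1 c (xs s) == m.1, phi2 m.1 (y1s s) == m.2 & ~~ psi2 m.1 m.2 (y2s s)].
have [mm] := pigeonhole (fun m => iid_mean P n (fun s => (box m s)%:R)) (x0, z0).
rewrite -iid_mean_sum (eq_iid_mean _ _ _ _ (code_accept2 n c)) -accept_prob2.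
rewrite card_prod !card_ord.
set a := (1 - _) / _; set p := iid_mean _ _ _ => ap.
have a0 : 0 <= a.
  by rewrite divr_ge0 ?ler0n // accept_prob2 iid_mean_ge0.
have sub (E F : pred {ffun 'I_n -> T}) (r : {ffun T -> R}) : is_pmf r ->
    (forall s, E s -> F s) -> iid_mean r n (fun s => (E s)%:R) <= iid_mean r n (fun s => (F s)%:R).
  by move=> pr EF; apply: ler_iid_mean => // s; have := EF s; case: (E s) => // ->.
have [m1 m2] := mm.
have := iid_box_lower_bound q Pb b m pmfq pmfPb b0 bPb m0 n
  (fun x => phi1 c x == mm.1) (fun y => phi2 mm.1 y == mm.2) (fun z => ~~ psi2 mm.1 mm.2 z).
rewrite (iid_mean_eq_push (@pX X Y1 Y2) q P n (fun x => (phi1 c x == mm.1)%:R) qX).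
rewrite (iid_mean_eq_push (@pY1 X Y1 Y2) q P n (fun y => (phi2 mm.1 y == mm.2)%:R) qY1).
rewrite (iid_mean_eq_push (@pY2 X Y1 Y2) q P n (fun z => (~~ psi2 mm.1 mm.2 z)%:R) qY2).
move=> H; apply: (@le_trans _ _ (iid_mean Pb n (fun s => (box mm s)%:R))); last first.
  rewrite /beta2 seqprobE; apply: sub => // s /and3P[/eqP h1 /eqP h2 h3].
  by rewrite /dec2 h1 h2.
apply: le_trans H; rewrite exprM ler_wpM2l //.
  by rewrite exprn_ge0 // ltW // box_rate_gt0.
rewrite lerXn2r ?nnegrE ?exprn_ge0 //.
  by rewrite !mulr_ge0 ?iid_mean_ge0.
rewrite !exprS expr0 mulr1 mulrA.
have le1 (E : pred {ffun 'I_n -> T}) : (forall s, box mm s -> E s) ->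
    a <= iid_mean P n (fun s => (E s)%:R).
  by move=> h; apply: le_trans ap _; exact: sub.
have A1 := le1 (fun s => phi1 c (xs s) == mm.1).
have A2 := le1 (fun s => phi2 mm.1 (y1s s) == mm.2).
have A3 := le1 (fun s => ~~ psi2 mm.1 mm.2 (y2s s)).
apply: ler_pM; [exact: mulr_ge0 | exact: a0 | apply: ler_pM => // | ].
- by apply: A1 => s /and3P[].
- by apply: A2 => s /and3P[].
- by apply: A3 => s /and3P[].
Qed.

(* Completing [q] with the conditional law of [Y2] under [Pb] keeps the
   divergence; the marginal on [Y2] is then arbitrary, which is harmless since
   Detector 1 imposes no constraint on [Y2]. *)
Definition lift_pmf (q : {ffun X * Y1 -> R}) : {ffun T -> R} :=
  [ffun t : T => q (pXY1 t) * (Pb t / push (@pXY1 X Y1 Y2) Pb (pXY1 t))].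

Lemma push_pXY1_gt0 (t : T) : 0 < push (@pXY1 X Y1 Y2) Pb (pXY1 t).
Proof.
rewrite ffunE (bigD1 t) //= ltr_pwDl // sumr_ge0 // => i _; exact: ltW.
Qed.

Lemma push_lift_pmf q : push (@pXY1 X Y1 Y2) (lift_pmf q) = q.
Proof.
have [t0 _] := pmf_inhabited pmfP.
apply/ffunP => u; rewrite ffunE.
rewrite (eq_bigr (fun t => q u / push (@pXY1 X Y1 Y2) Pb u * Pb t)); last first.
  by move=> t /eqP tu; rewrite ffunE tu; ring.
have : 0 < push (@pXY1 X Y1 Y2) Pb u by rewrite -[u]/(pXY1 (u, pY2 t0)) push_pXY1_gt0.
move=> h; rewrite -big_distrr /= -mulrA [X in _ * (_ * X)](_ : _ = push (@pXY1 X Y1 Y2) Pb u).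
  by rewrite mulVf ?mulr1 // gt_eqF.
by rewrite ffunE.
Qed.

Lemma KL_lift_pmf q : KL (lift_pmf q) Pb = KL q (push (@pXY1 X Y1 Y2) Pb).
Proof.
rewrite !KLE -[in RHS](push_lift_pmf q) sum_push; apply: eq_bigr => t _.
congr (_ * ln _); rewrite push_lift_pmf ffunE; have := push_pXY1_gt0 t => h.
by field; rewrite !gt_eqF.
Qed.

Lemma is_pmf_lift q : is_pmf q -> is_pmf (lift_pmf q).
Proof.
move=> [q0 q1]; split=> [t|].
  by rewrite ffunE !mulr_ge0 // ?ltW // invr_gt0 push_pXY1_gt0.
have := sum_push (@pXY1 X Y1 Y2) (lift_pmf q) (fun=> 1).
rewrite push_lift_pmf; under eq_bigr do rewrite mulr1.
by under [RHS]eq_bigr do rewrite mulr1; rewrite q1 => <-.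
Qed.

(** The same argument for [lift_pmf q], with boxes whose third side is the whole space and has mean
    1; only two factors remain. *)
Lemma beta1_lower_bound (q : {ffun X * Y1 -> R}) n (c : Defs.code X Y1 Y2 n) :
  feas1 P q ->
  box_rate (lift_pmf q) Pb b m ^+ n *
    ((1 - alpha1 P c) / (size1 c)%:R) ^+ (2 * m.+1) <= beta1 Pb c.
Proof.
move=> [pmfq [qX qY1]]; have [t0 _] := pmf_inhabited pmfP.
pose q' := lift_pmf q; have pmfq' : is_pmf q' by exact: is_pmf_lift.
have q'X : push (@pX X Y1 Y2) q' = push (@pX X Y1 Y2) P.
  by rewrite -qX -(push_lift_pmf q) -push_comp.
have q'Y1 : push (@pY1 X Y1 Y2) q' = push (@pY1 X Y1 Y2) P.
  by rewrite -qY1 -(push_lift_pmf q) -push_comp.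
rewrite -/q'.
pose box (m : 'I_(size1 c)) (s : {ffun 'I_n -> T}) :=
  [&& phi1 c (xs s) == m, ~~ psi1 m (y1s s) & true].
have [mm] := pigeonhole (fun m => iid_mean P n (fun s => (box m s)%:R))
  (phi1 c (xs [ffun=> t0])).
rewrite -iid_mean_sum (eq_iid_mean _ _ _ _ (code_accept1 n c)) -accept_prob1 card_ord.
set a := (1 - _) / _; set p := iid_mean _ _ _ => ap.
have a0 : 0 <= a.
  by rewrite divr_ge0 ?ler0n // accept_prob1 iid_mean_ge0.
have sub (E F : pred {ffun 'I_n -> T}) (r : {ffun T -> R}) : is_pmf r ->
    (forall s, E s -> F s) -> iid_mean r n (fun s => (E s)%:R) <= iid_mean r n (fun s => (F s)%:R).
  by move=> pr EF; apply: ler_iid_mean => // s; have := EF s; case: (E s) => // ->.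
have := iid_box_lower_bound q' Pb b m pmfq' pmfPb b0 bPb m0 n
  (fun x => phi1 c x == mm) (fun y => ~~ psi1 mm y) predT.
rewrite (iid_mean_eq_push (@pX X Y1 Y2) q' P n (fun x => (phi1 c x == mm)%:R) q'X).
rewrite (iid_mean_eq_push (@pY1 X Y1 Y2) q' P n (fun y => (~~ psi1 mm y)%:R) q'Y1).
rewrite iid_mean1 // mulr1.
move=> H; apply: (@le_trans _ _ (iid_mean Pb n (fun s => (box mm s)%:R))); last first.
  rewrite /beta1 seqprobE; apply: sub => // s /and3P[/eqP h1 h2 _].
  by rewrite /dec1 h1.
apply: le_trans H; rewrite exprM ler_wpM2l //.
  by rewrite exprn_ge0 // ltW // box_rate_gt0.
rewrite lerXn2r ?nnegrE ?exprn_ge0 //.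
  by rewrite !mulr_ge0 ?iid_mean_ge0.
have le1 (E : pred {ffun 'I_n -> T}) : (forall s, box mm s -> E s) ->
    a <= iid_mean P n (fun s => (E s)%:R).
  by move=> h; apply: le_trans ap _; exact: sub.
rewrite expr2; apply: ler_pM => //.
- by apply: le1 => s /and3P[].
- by apply: le1 => s /and3P[].
Qed.

End Converse.

(** Any error level below 1 leaves a fixed positive acceptance probability, which is all that the
    strong converse requires. *)
Lemma limsup_le_accept {R : realType} (al : nat -> R) (e : R) : e < 1 -> limsup_le al e ->
  exists N, forall n, (N <= n)%N -> (1 - e) / 2 <= 1 - al n.
Proof.
move=> e1 h; have d0 : 0 < (1 - e) / 2 by lra.
have [N hN] := h _ d0; exists N => n /hN; lra.
Qed.

Lemma size1_gt0 {X Y1 Y2 : finType} n (c : Defs.code X Y1 Y2 n) : X -> (0 < size1 c)%N.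
Proof. by move=> x; exact: leq_ltn_trans (ltn_ord (phi1 c [ffun=> x])). Qed.

Lemma size2_gt0 {X Y1 Y2 : finType} n (c : Defs.code X Y1 Y2 n) : X -> Y1 -> (0 < size2 c)%N.
Proof.
by move=> x y; exact: leq_ltn_trans (ltn_ord (phi2 (phi1 c [ffun=> x]) [ffun=> y])).
Qed.

Lemma achievable_le_theta_star {R : realType} {X Y1 Y2 : finType}
    (P Pb : {ffun ((X * Y1) * Y2)%type -> R}) (e1 e2 : R) (th : R * R) :
  is_pmf P -> is_pmf Pb -> (forall t, 0 < Pb t) -> e1 < 1 -> e2 < 1 ->
  achievable P Pb 0 0 e1 e2 th ->
  th.1 <= theta1_star P Pb /\ th.2 <= theta2_star P Pb.
Proof.
move=> pmfP pmfPb Pb0 e1lt e2lt [_ [_ [c [al1 [al2 [be1 [be2 [r1 r2]]]]]]]].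
have [[[x0 y0] z0] _] := pmf_inhabited pmfP.
have [b /andP[b0 _] bPb] := pos_lower_bound Pb0.
have s1 n := size1_gt0 n (c n) x0; have s2 n := size2_gt0 n (c n) x0 y0.
have C0 : 0 <= 728 / b by apply: divr_ge0; [exact: ler0n | exact: ltW].
split; apply: lb_le_inf.
(* The infimum is over a nonempty set: the marginal of [P] itself is feasible. *)
- exists (KL (push (@pXY1 X Y1 Y2) P) (push (@pXY1 X Y1 Y2) Pb)).
  exists (push (@pXY1 X Y1 Y2) P) => //.
  by split; [exact: is_pmf_push | rewrite -!push_comp].
- move=> _ [q fq <-]; rewrite -(KL_lift_pmf P Pb pmfP Pb0).
  (* Here [m] is fixed while the blocklength grows; it tends to infinity only afterwards, which
     removes the excess [728 / (b m)]. *)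
  apply: (le_of_le_add_div _ _ _ C0) => m m0.
  apply: le_trans (le_box_rate _ _ _ _ b0).
  apply: (exponent_upper_bound _ (fun n => size1 (c n)) ((1 - e1) / 2) _ _
    (2 * m.+1) _ _ _ r1 be1) => //.
  + lra.
  + exact: box_rate_gt0.
  + have [N hN] := limsup_le_accept _ _ e1lt al1; exists N => n Nn.
    apply: le_trans (beta1_lower_bound P Pb pmfP pmfPb Pb0 b m b0 bPb m0 q n (c n) fq).
    rewrite ler_wpM2l ?exprn_ge0 ?(ltW (box_rate_gt0 _ _ _ _ b0)) //.
    have a0 : 0 <= (1 - e1) / 2 by lra.
    have h := hN n Nn; move: (_ / 2) a0 h => a a0 h.
    rewrite lerXn2r ?nnegrE ?divr_ge0 ?ler0n ?(le_trans a0 h) //.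
    by rewrite ler_wpM2r ?invr_ge0 ?ler0n.
- by exists (KL P Pb); exists P.
- move=> _ [q fq <-]; apply: (le_of_le_add_div _ _ _ C0) => m m0.
  apply: le_trans (le_box_rate _ _ _ _ b0).
  apply: (exponent_upper_bound _ (fun n => size1 (c n) * size2 (c n))%N ((1 - e2) / 2) _ _
    (3 * m.+1) _ _ _ (rate_le_mul _ _ r1 r2) be2) => //.
  + lra.
  + exact: box_rate_gt0.
  + by move=> n; rewrite muln_gt0 s1 s2.
  + have [N hN] := limsup_le_accept _ _ e2lt al2; exists N => n Nn.
    apply: le_trans (beta2_lower_bound P Pb pmfP pmfPb b m b0 bPb m0 q n (c n) fq).
    rewrite ler_wpM2l ?exprn_ge0 ?(ltW (box_rate_gt0 _ _ _ _ b0)) //.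
    have a0 : 0 <= (1 - e2) / 2 by lra.
    have h := hN n Nn; move: (_ / 2) a0 h => a a0 h.
    rewrite lerXn2r ?nnegrE ?divr_ge0 ?ler0n ?(le_trans a0 h) //.
    by rewrite ler_wpM2r ?invr_ge0 ?ler0n.
Qed.

(** * Method of types *)

Definition occ {T : finType} {n} (s : {ffun 'I_n -> T}) (t : T) : nat := #|[pred i | s i == t]|.

Definition empirical {R : realType} {T : finType} {n} (s : {ffun 'I_n -> T}) : {ffun T -> R} :=
  [ffun t => (occ s t)%:R / n%:R].

Section Types.
Context {R : realType} {T : finType}.
Implicit Types p : {ffun T -> R}.

Lemma sum_empirical n (s : {ffun 'I_n -> T}) (F : T -> R) : (0 < n)%N ->
  \sum_i F (s i) = n%:R * \sum_t empirical s t * F t.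
Proof.
move=> n0; rewrite (partition_big s predT) //= big_distrr; apply: eq_bigr => t _ /=.
rewrite (eq_bigr (fun=> F t)); last by move=> i /eqP ->.
rewrite sumr_const ffunE -/(occ s t) -[LHS]mulr_natl; field.
by rewrite pnatr_eq0 -lt0n.
Qed.

Lemma is_pmf_empirical n (s : {ffun 'I_n -> T}) : (0 < n)%N ->
  is_pmf (empirical s : {ffun T -> R}).
Proof.
move=> n0; split=> [t|]; first by rewrite ffunE divr_ge0.
have nR : n%:R != 0 :> R by rewrite pnatr_eq0 -lt0n.
apply: (mulfI nR); rewrite mulr1 -[RHS](_ : \sum_(i < n) 1 = _).
  by rewrite (sum_empirical n s (fun=> 1) n0); congr (_ * _); apply: eq_bigr => t _; rewrite mulr1.
by rewrite sumr_const card_ord.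
Qed.

Lemma push_empirical {U : finType} n (f : T -> U) (s : {ffun 'I_n -> T}) :
  push f (empirical s) = empirical (map_seq f s) :> {ffun U -> R}.
Proof.
apply/ffunP => u; rewrite !ffunE; under eq_bigr do rewrite ffunE.
rewrite -big_distrl -natr_sum; congr (_%:R / _).
rewrite /occ -[RHS]sum1_card [RHS](partition_big s (fun t => f t == u)) /=; last first.
  by move=> i; rewrite inE ffunE.
apply: eq_bigr => t /eqP ftu; rewrite -sum1_card; apply: eq_bigl => i.
by rewrite !inE ffunE; have [->|] := eqVneq (s i) t; rewrite ?ftu ?eqxx ?andbF.
Qed.

Lemma empirical_gt0 n (s : {ffun 'I_n -> T}) i : 0 < (empirical s (s i) : R).
Proof.
rewrite ffunE divr_gt0 ?ltr0n //; last exact: leq_ltn_trans (ltn_ord i).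
by apply/card_gt0P; exists i; rewrite inE.
Qed.

(** Collecting equal letters turns the log-likelihood ratio of the type to [p] into [n] times the
    divergence; the type is positive at every letter that occurs. *)
Lemma iid_prob_type p n (s : {ffun 'I_n -> T}) : (0 < n)%N -> (forall t, 0 < p t) ->
  \prod_i p (s i) = expR (- (n%:R * KL (empirical s) p)) * \prod_i empirical s (s i).
Proof.
move=> n0 p0; rewrite KLE -(sum_empirical n s (fun t => ln (empirical s t / p t)) n0).
rewrite -sumrN expR_sum -big_split; apply: eq_bigr => i _ /=.
have e0 := empirical_gt0 n s i.
rewrite expRN lnK ?posrE ?divr_gt0 // invf_div mulfVK //; exact: lt0r_neq0.
Qed.

(* Each of the at most [n.+1 ^ #|T|] type classes contributes at most 1. *)
Lemma sum_max_likelihood n : (0 < n)%N ->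
  \sum_(s : {ffun 'I_n -> T}) \prod_i (empirical s (s i) : R) <= (n.+1 ^ #|T|)%:R.
Proof.
move=> n0; pose k (s : {ffun 'I_n -> T}) : {ffun T -> 'I_n.+1} := [ffun t => inord (occ s t)].
have kE s s' : k s = k s' -> empirical s = empirical s' :> {ffun T -> R}.
  move=> /ffunP kss; apply/ffunP => t; rewrite !ffunE; congr (_%:R / _).
  have := kss t; rewrite !ffunE => /(congr1 val) /=; rewrite !inordK //.
    by rewrite ltnS -[leqRHS]card_ord max_card.
  by rewrite ltnS -[leqRHS]card_ord max_card.
rewrite (partition_big k predT) //=.
have -> : (n.+1 ^ #|T|)%:R = \sum_(f : {ffun T -> 'I_n.+1}) 1 :> R.
  by rewrite sumr_const card_ffun card_ord.
apply: ler_sum => f _; have [/existsP[s0 /eqP <-]|] := boolP [exists s, k s == f]; last first.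
  move=> /existsPn nf; rewrite big_pred0 // => s; exact/negbTE/nf.
(* On one class the type is constant, so the sum is the probability of the class under that common
   law. *)
rewrite -[leRHS](iid_mean1 (empirical s0) n (is_pmf_empirical _ _ n0)).
rewrite (eq_bigr (fun s : {ffun 'I_n -> T} => \prod_i (empirical s0 (s i) : R))); last first.
  by move=> s /eqP /kE ->.
rewrite big_mkcond; apply: ler_sum => s _; rewrite mulr1.
by case: ifP => // _; apply: prodr_ge0 => i _; rewrite ffunE divr_ge0.
Qed.

(** Upper half of Sanov's theorem: once [exp (- n K)] is factored out, a sum of maximum likelihoods
    remains, which is polynomial in [n]. *)
Lemma iid_prob_le_types p n (E : pred {ffun 'I_n -> T}) K : (0 < n)%N -> (forall t, 0 < p t) ->
  (forall s, E s -> K <= KL (empirical s) p) ->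
  iid_mean p n (fun s => (E s)%:R) <= (n.+1 ^ #|T|)%:R * expR (- (n%:R * K)).
Proof.
move=> n0 p0 hE; rewrite mulrC.
apply: le_trans (ler_wpM2l (expR_ge0 _) (sum_max_likelihood _ n0)).
rewrite big_distrr; apply: ler_sum => s _ /=.
have M0 : 0 <= \prod_i (empirical s (s i) : R).
  by apply: prodr_ge0 => i _; rewrite ltW ?empirical_gt0.
case Es: (E s); last by rewrite mulr0 mulr_ge0 ?expR_ge0.
rewrite mulr1 iid_prob_type // ler_wpM2r // ler_expR lerN2 ler_wpM2l //.
exact: hE.
Qed.

End Types.

Lemma natS_le_expR {R : realType} (d : R) : 0 < d ->
  exists N, forall n, (N <= n)%N -> n.+1%:R <= expR (n%:R * d).
Proof.
(* From [4 <= n d^2] the quadratic term of [(1 + n d / 2)^2] is at least [n]. *)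
move=> d0; exists (Num.bound (4 / d ^+ 2)) => n Nn.
have x0 : 0 <= 4 / d ^+ 2 by rewrite divr_ge0 // exprn_ge0 // ltW.
have : 4 / d ^+ 2 <= n%:R by apply: le_trans (ltW (archi_boundP x0)) _; rewrite ler_nat.
rewrite ler_pdivrMr ?exprn_gt0 // => h.
have -> : expR (n%:R * d) = expR (n%:R * d / 2) ^+ 2.
  by rewrite -expRM_natl; congr expR; field.
have n0 : 0 <= n%:R :> R by [].
have nd : 0 <= n%:R * d / 2 by rewrite !mulr_ge0 // ltW.
apply: (@le_trans _ _ ((1 + n%:R * d / 2) ^+ 2)).
  have h2 := ler_wpM2l n0 h.
  have -> : n.+1%:R = n%:R + 1 :> R by rewrite -natr1.
  have -> : (1 + n%:R * d / 2) ^+ 2 = 1 + n%:R * d + n%:R * (n%:R * d ^+ 2) / 4 :> R by field.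
  have : 0 <= n%:R * d by rewrite mulr_ge0 // ltW.
  lra.
by rewrite lerXn2r ?nnegrE ?expR_ge0 ?addr_ge0 // expR_ge1Dx.
Qed.

Lemma poly_le_expR {R : realType} (k : nat) (d : R) : 0 < d ->
  exists N, forall n, (N <= n)%N -> (n.+1 ^ k)%:R <= expR (n%:R * d).
Proof.
(* Dividing by [k + 1] covers [k = 0] as well. *)
move=> d0; have e0 : 0 < d / k.+1%:R by rewrite divr_gt0 // ltr0n.
have [N hN] := natS_le_expR _ e0; exists N => n /hN h.
apply: (@le_trans _ _ ((n.+1%:R) ^+ k.+1)); first by rewrite -natrX ler_nat leq_pexp2l.
apply: (@le_trans _ _ (expR (n%:R * (d / k.+1%:R)) ^+ k.+1)).
  by rewrite lerXn2r ?nnegrE ?expR_ge0.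
by rewrite -expRM_natr -mulrA mulfVK // pnatr_eq0.
Qed.

(** * Correction of marginals by mixing *)

(** Convexity of the divergence, together with [KL r p <= - ln c], which holds since [r <= 1] and
    [p >= c]. *)
Lemma KL_mixture_le {R : realType} {T : finType} (q r p : {ffun T -> R}) (tau c : R) :
  0 <= tau <= 1 -> is_pmf q -> is_pmf r -> is_pmf p -> (forall t, 0 < p t) ->
  0 < c -> (forall t, c <= p t) ->
  KL [ffun t => (1 - tau) * q t + tau * r t] p <= KL q p - tau * ln c.
Proof.
move=> /andP[t0 t1] pq pr pp p0 c0 cp; have [q0 q1] := pq; have [r0 r1] := pr.
have KLr : KL r p <= - ln c.
  rewrite KLE -[leRHS]mul1r -r1 big_distrl; apply: ler_sum => t _ /=.
  have := r0 t; rewrite le0r => /predU1P[->|rt]; first by rewrite !mul0r.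
  rewrite ler_wpM2l // ln_div ?posrE // lerBlDr addrC; apply: (@le_trans _ _ 0).
    exact/ln_le0/pmf_le1.
  by rewrite subr_ge0 ler_ln ?posrE.
have KLq : 0 <= KL q p by exact: KL_ge0.
apply: (@le_trans _ _ ((1 - tau) * KL q p + tau * KL r p)); last first.
  have := ler_wpM2l t0 KLr; nra.
rewrite !KLE !big_distrr -big_split; apply: ler_sum => t _ /=; rewrite ffunE.
set z := _ + _.
(* Tangent inequality at the mixture value [z]; the corrections [x - z] cancel when averaged over
   [q t] and [r t] with the mixing weights. *)
have rel x : 0 <= x -> 0 < z -> x * ln (z / p t) + (x - z) <= x * ln (x / p t).
  rewrite le0r => /predU1P[->|x0 z0]; first by move=> ?; rewrite !mul0r; lra.
  have := @le_ln1Dx R (z / x - 1); rewrite [1 + _]addrC subrK ltrBrDl subrr.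
  move=> /(_ (divr_gt0 z0 x0)) /(ler_wpM2l (ltW x0)).
  rewrite !ln_div ?posrE // => h.
  have -> : x - z = - (x * (z / x - 1)) by field; rewrite gt_eqF.
  lra.
have z0 : 0 <= z by rewrite addr_ge0 // mulr_ge0 // subr_ge0.
move: z0; rewrite le0r => /predU1P[zE|z0].
  have qz : (1 - tau) * q t = 0.
    apply/eqP; rewrite eq_le mulr_ge0 ?subr_ge0 // andbT -zE lerDl mulr_ge0 //.
  have rz : tau * r t = 0.
    apply/eqP; rewrite eq_le mulr_ge0 // andbT -zE lerDr mulr_ge0 ?subr_ge0 //.
  by rewrite zE mul0r !mulrA qz rz !mul0r addr0.
have tq : 0 <= 1 - tau by rewrite subr_ge0.
have := ler_wpM2l tq (rel _ (q0 t) z0); have := ler_wpM2l t0 (rel _ (r0 t) z0).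
have : (1 - tau) * (q t - z) + tau * (r t - z) = 0 by rewrite /z; ring.
have : z * ln (z / p t) = (1 - tau) * (q t * ln (z / p t)) + tau * (r t * ln (z / p t)).
  by rewrite /z; ring.
lra.
Qed.

Definition prod_pmf {R : realType} {U V : finType} (p : {ffun U -> R}) (q : {ffun V -> R}) :
  {ffun U * V -> R} := [ffun t => p t.1 * q t.2].

(* The law that completes [(1 - tau) q] to [p]. *)
Definition residual {R : realType} {U : finType} (tau : R) (p q : {ffun U -> R}) :
  {ffun U -> R} := [ffun u => (p u - (1 - tau) * q u) / tau].

Section Tilt.
Context {R : realType}.

Lemma sum_fst_prod {U V : finType} (F : U * V -> R) u :
  \sum_(t | t.1 == u) F t = \sum_v F (u, v).
Proof.
transitivity (\sum_(a | a == u) \sum_v F (a, v)); last by rewrite big_pred1_eq.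
by rewrite pair_big; apply: eq_big => [[a b]|[a b] _]; rewrite ?andbT.
Qed.

Lemma sum_snd_prod {U V : finType} (F : U * V -> R) v :
  \sum_(t | t.2 == v) F t = \sum_u F (u, v).
Proof.
transitivity (\sum_a \sum_(b | b == v) F (a, b)).
  by rewrite pair_big; apply: eq_big => [[a b]|[a b] _].
by apply: eq_bigr => a _; rewrite big_pred1_eq.
Qed.

Lemma push_fst_prod {U V : finType} (p : {ffun U -> R}) (q : {ffun V -> R}) :
  is_pmf q -> push fst (prod_pmf p q) = p.
Proof.
move=> [_ q1]; apply/ffunP => u; rewrite ffunE sum_fst_prod.
under eq_bigr do rewrite ffunE /=.
by rewrite -big_distrr /= q1 mulr1.
Qed.

Lemma push_snd_prod {U V : finType} (p : {ffun U -> R}) (q : {ffun V -> R}) :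
  is_pmf p -> push snd (prod_pmf p q) = q.
Proof.
move=> [_ p1]; apply/ffunP => v; rewrite ffunE sum_snd_prod.
under eq_bigr do rewrite ffunE /=.
by rewrite -big_distrl /= p1 mul1r.
Qed.

Lemma is_pmf_prod {U V : finType} (p : {ffun U -> R}) (q : {ffun V -> R}) :
  is_pmf p -> is_pmf q -> is_pmf (prod_pmf p q).
Proof.
move=> [p0 p1] [q0 q1]; split=> [t|]; first by rewrite ffunE mulr_ge0.
rewrite -p1 -{2}(push_fst_prod p q) //.
by rewrite (partition_big fst predT) //; apply: eq_bigr => u _; rewrite ffunE.
Qed.

Lemma is_pmf_residual {U : finType} (tau : R) (p q : {ffun U -> R}) :
  0 < tau -> is_pmf p -> is_pmf q -> (forall u, (1 - tau) * q u <= p u) ->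
  is_pmf (residual tau p q).
Proof.
move=> t0 [p0 p1] [q0 q1] h; split=> [u|].
  by rewrite ffunE divr_ge0 ?subr_ge0 // ltW.
under eq_bigr do rewrite ffunE /=.
rewrite -big_distrl /= sumrB -big_distrr /= p1 q1; field; exact: lt0r_neq0.
Qed.

Definition mixture {U : finType} (tau : R) (p q : {ffun U -> R}) : {ffun U -> R} :=
  [ffun t => (1 - tau) * p t + tau * q t].

Lemma push_mixture {U V : finType} (f : U -> V) tau (p q : {ffun U -> R}) :
  push f (mixture tau p q) = mixture tau (push f p) (push f q).
Proof.
apply/ffunP => v; rewrite !ffunE; under eq_bigr do rewrite ffunE /=.
by rewrite big_split -!big_distrr.
Qed.

Lemma mixture_residual {U : finType} tau (p q : {ffun U -> R}) : 0 < tau ->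
  mixture tau q (residual tau p q) = p.
Proof. by move=> t0; apply/ffunP => u; rewrite !ffunE; field; exact: lt0r_neq0. Qed.

Lemma is_pmf_mixture {U : finType} tau (p q : {ffun U -> R}) : 0 <= tau <= 1 ->
  is_pmf p -> is_pmf q -> is_pmf (mixture tau p q).
Proof.
move=> /andP[t0 t1] [p0 p1] [q0 q1]; split=> [u|].
  by rewrite ffunE addr_ge0 // mulr_ge0 // subr_ge0.
under eq_bigr do rewrite ffunE /=.
rewrite big_split -!big_distrr /= p1 q1; ring.
Qed.

Context {X Y1 Y2 : finType}.
Notation T := ((X * Y1) * Y2)%type.
Variables (P Pb : {ffun T -> R}) (tau c : R).
Hypotheses (pmfP : is_pmf P) (pmfPb : is_pmf Pb) (Pb0 : forall t, 0 < Pb t).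
Hypotheses (tau01 : 0 < tau <= 1) (c0 : 0 < c) (cPb : forall t, c <= Pb t).

Let tau0 : 0 < tau. Proof. by case/andP: tau01. Qed.
Let tau_itv : 0 <= tau <= 1. Proof. by case/andP: tau01 => /ltW -> ->. Qed.

(** The hypotheses make the three residuals pmfs. Their product is a joint law with these marginals,
    so mixing it into [q] gives a feasible point, to which [KL_mixture_le] applies. *)
Lemma theta2_star_le (q : {ffun T -> R}) : is_pmf q ->
  (forall x, (1 - tau) * push (@pX X Y1 Y2) q x <= push (@pX X Y1 Y2) P x) ->
  (forall y, (1 - tau) * push (@pY1 X Y1 Y2) q y <= push (@pY1 X Y1 Y2) P y) ->
  (forall z, (1 - tau) * push (@pY2 X Y1 Y2) q z <= push (@pY2 X Y1 Y2) P z) ->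
  theta2_star P Pb <= KL q Pb - tau * ln c.
Proof.
move=> pq hX hY hZ.
pose rX := residual tau (push (@pX X Y1 Y2) P) (push (@pX X Y1 Y2) q).
pose rY := residual tau (push (@pY1 X Y1 Y2) P) (push (@pY1 X Y1 Y2) q).
pose rZ := residual tau (push (@pY2 X Y1 Y2) P) (push (@pY2 X Y1 Y2) q).
have prX : is_pmf rX by apply: is_pmf_residual => //; exact: is_pmf_push.
have prY : is_pmf rY by apply: is_pmf_residual => //; exact: is_pmf_push.
have prZ : is_pmf rZ by apply: is_pmf_residual => //; exact: is_pmf_push.
pose r := prod_pmf (prod_pmf rX rY) rZ.
have pr : is_pmf r by do 2?apply: is_pmf_prod.
apply: le_trans (KL_mixture_le q r Pb tau c tau_itv pq pr pmfPb Pb0 c0 cPb).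
apply: ge_inf.
  by exists 0 => _ [p [pp _] <-]; exact: KL_ge0.
exists (mixture tau q r) => //; split; first exact: is_pmf_mixture.
have prXY : is_pmf (prod_pmf rX rY) by exact: is_pmf_prod.
split; [|split]; rewrite push_mixture.
- rewrite (push_comp fst fst r) push_fst_prod // push_fst_prod //; exact: mixture_residual.
- rewrite (push_comp fst snd r) push_fst_prod // push_snd_prod //; exact: mixture_residual.
- rewrite push_snd_prod //; exact: mixture_residual.
Qed.

Lemma theta1_star_le (q : {ffun X * Y1 -> R}) : is_pmf q ->
  (forall x, (1 - tau) * push fst q x <= push (@pX X Y1 Y2) P x) ->
  (forall y, (1 - tau) * push snd q y <= push (@pY1 X Y1 Y2) P y) ->
  theta1_star P Pb <= KL q (push (@pXY1 X Y1 Y2) Pb) - tau * ln c.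
Proof.
move=> pq hX hY; have [t0 _] := pmf_inhabited pmfP.
pose rX := residual tau (push (@pX X Y1 Y2) P) (push fst q).
pose rY := residual tau (push (@pY1 X Y1 Y2) P) (push snd q).
have prX : is_pmf rX by apply: is_pmf_residual => //; exact: is_pmf_push.
have prY : is_pmf rY by apply: is_pmf_residual => //; exact: is_pmf_push.
pose r := prod_pmf rX rY.
have pr : is_pmf r by apply: is_pmf_prod.
(* A marginal probability dominates any single atom above it, so [c] serves for the pair law too. *)
have cXY u : c <= push (@pXY1 X Y1 Y2) Pb u.
  rewrite ffunE (bigD1 (u, pY2 t0)) //=; apply: le_trans (cPb (u, pY2 t0)) _.
  by rewrite lerDl sumr_ge0 // => t _; exact: ltW.
have pXY0 u : 0 < push (@pXY1 X Y1 Y2) Pb u by exact: lt_le_trans (cXY u).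
have pmfXY := is_pmf_push (@pXY1 X Y1 Y2) Pb pmfPb.
apply: le_trans (KL_mixture_le q r _ tau c tau_itv pq pr pmfXY pXY0 c0 cXY).
apply: ge_inf.
  by exists 0 => _ [p [pp _] <-]; exact: KL_ge0.
exists (mixture tau q r) => //; split; first exact: is_pmf_mixture.
split; rewrite push_mixture.
- rewrite push_fst_prod //; exact: mixture_residual.
- rewrite push_snd_prod //; exact: mixture_residual.
Qed.

End Tilt.

(* Only the upper deviations are constrained: this is exactly what makes
   [residual tau p (empirical s)] nonnegative, and it forbids symbols of
   [p]-probability zero. *)
Definition typical {R : realType} {U : finType} (tau : R) (p : {ffun U -> R}) n
    (s : {ffun 'I_n -> U}) : bool :=
  [forall u, (1 - tau) * empirical s u <= p u].

(** * Concentration of types *)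

(** A symbol of probability zero almost surely does not occur, so any rate works; for the others
    this is a Chernoff bound on the number of occurrences. *)
Lemma chernoff_symbol {R : realType} {U : finType} (p : {ffun U -> R}) (tau : R) (u : U) :
  is_pmf p -> 0 < tau < 1 -> exists2 k, 0 < k & forall n, (0 < n)%N ->
    iid_mean p n (fun s => ((p u < (1 - tau) * empirical s u)%R)%:R) <= expR (- (n%:R * k)).
Proof.
move=> pp /andP[t0 t1]; have [p0 p1] := pp.
have [pu0|pu] := eqVneq (p u) 0.
  exists 1 => // n n0; apply: (@le_trans _ _ 0); last exact: expR_ge0.
  apply: sumr_le0 => s _; rewrite pu0.
  case emp: (0 < _); last by rewrite mulr0.
  have : 0 < (empirical s u : R).
    by move: emp; rewrite pmulr_rgt0 // subr_gt0.
  rewrite ffunE pmulr_lgt0 ?invr_gt0 ?ltr0n // => /card_gt0P[i]; rewrite inE => /eqP siu.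
  by rewrite (bigD1 i) //= siu pu0 !mul0r.
have pu0 : 0 < p u by rewrite lt_def pu p0.
(* The threshold [p u / (1 - tau)] contributes the first term of [k], the bound
   [exp b - 1 <= b / (1 - b)] the second; [b < tau] makes the difference positive. *)
pose b := tau / 2; pose k := p u * (b / (1 - tau) - b / (1 - b)).
have b0 : 0 < b by rewrite divr_gt0.
have bt : b < tau by rewrite /b; lra.
have k0 : 0 < k.
  rewrite mulr_gt0 // subr_gt0 ltr_pM2l // ltf_pV2 ?posrE; lra.
exists k => // n n0; have nR : 0 < n%:R :> R by rewrite ltr0n.
pose g t := expR (b * ((t == u)%:R - p u / (1 - tau))).
apply: (@le_trans _ _ (iid_mean p n (fun s => \prod_i g (s i)))).
  apply: ler_iid_mean => // s.
  have -> : \prod_i g (s i) = expR (n%:R * (b * (empirical s u - p u / (1 - tau)))).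
    rewrite -expR_sum (sum_empirical n s (fun t => b * ((t == u)%:R - p u / (1 - tau)))) //.
    congr (expR (_ * _)); under eq_bigr do rewrite mulrCA mulrBr.
    rewrite -big_distrr sumrB -big_distrl /= (is_pmf_empirical n s n0).2 mul1r.
    rewrite (bigD1 u) //= eqxx mulr1 big1 ?addr0 // => t /negbTE ->.
    by rewrite mulr0.
  case E: (_ < _); last exact: expR_ge0.
  rewrite -[leLHS]expR0 ler_expR mulr_ge0 ?ler0n // mulr_ge0 ?(ltW b0) //.
  by rewrite subr_ge0 ler_pdivrMr ?subr_gt0 // mulrC ltW.
rewrite iid_mean_prod -mulrN expRM_natl lerXn2r ?nnegrE ?expR_ge0 //.
  by apply: sumr_ge0 => t _; rewrite mulr_ge0 ?expR_ge0.
have -> : \sum_t p t * g t = expR (- (b * (p u / (1 - tau)))) * (1 + p u * (expR b - 1)).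
  rewrite (bigD1 u) //= /g eqxx mulrBr mulr1 expRD.
  rewrite (eq_bigr (fun t => expR (- (b * (p u / (1 - tau)))) * p t)); last first.
    by move=> t /negbTE ->; rewrite sub0r mulrN mulrC.
  rewrite -big_distrr /=; have -> : \sum_(t | t != u) p t = 1 - p u.
    by have := p1; rewrite (bigD1 u) //= => h; lra.
  ring.
apply: (@le_trans _ _ (expR (- (b * (p u / (1 - tau)))) * expR (p u * (b / (1 - b))))).
  rewrite ler_wpM2l ?expR_ge0 //; apply: le_trans (expR_ge1Dx _).
  rewrite lerD2l ler_wpM2l //.
  have := expR_ge1Dx (- b); rewrite expRN => h.
  have b1 : 0 < 1 - b by lra.
  have : expR b <= (1 - b)^-1 by rewrite -[leLHS]invrK lef_pV2 ?posrE ?invr_gt0 ?expR_gt0.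
  have : (1 - b)^-1 = b / (1 - b) + 1 by field; rewrite gt_eqF.
  lra.
rewrite -expRD ler_expR le_eqVlt /k; apply/orP; left; apply/eqP; ring.
Qed.

Lemma typical_prob {R : realType} {U : finType} (p : {ffun U -> R}) (tau d : R) :
  is_pmf p -> 0 < tau < 1 -> 0 < d -> exists N, forall n, (N <= n)%N ->
    iid_mean p n (fun s => (~~ typical tau p n s)%:R) <= d.
Proof.
move=> pp tau01 d0.
have /choice [k hk] : forall u, exists k, 0 < k /\ forall n, (0 < n)%N ->
    iid_mean p n (fun s => ((p u < (1 - tau) * empirical s u)%R)%:R) <= expR (- (n%:R * k)).
  by move=> u; have [k k0 hk] := chernoff_symbol p tau u pp tau01; exists k.
have [c /andP[c0 _] ck] : exists2 c, 0 < c <= 1 &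
    forall u, c <= ([ffun u => k u] : {ffun U -> R}) u.
  by apply: pos_lower_bound => u; rewrite ffunE; have [] := hk u.
(* For [n >= B] one has [#|U| / d <= n c <= exp (n c)], so the union bound is at most [d]. *)
pose B := #|U|%:R / d / c; have B0 : 0 <= B by rewrite !divr_ge0 // ltW.
exists (Num.bound B).+1 => n Nn; have n0 : (0 < n)%N by exact: leq_trans Nn.
apply: (@le_trans _ _ (\sum_u iid_mean p n (fun s => ((p u < (1 - tau) * empirical s u)%R)%:R))).
  rewrite -iid_mean_sum; apply: ler_iid_mean => // s.
  case E: (~~ _); last by rewrite sumr_ge0.
  move/forallPn: E => [u]; rewrite -ltNge => pu.
  by rewrite (bigD1 u) //= pu lerDl sumr_ge0.
apply: (@le_trans _ _ (\sum_(u : U) expR (- (n%:R * c)))).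
  apply: ler_sum => u _; apply: le_trans ((hk u).2 n n0) _.
  rewrite ler_expR lerN2 ler_wpM2l //; have := ck u; by rewrite ffunE.
rewrite sumr_const -[leLHS]mulr_natl expRN ler_pdivrMr ?expR_gt0 // mulrC -ler_pdivrMr //.
apply: le_trans (expR_ge1Dx _).
have : B <= n%:R.
  by apply: le_trans (ltW (archi_boundP B0)) _; rewrite ler_nat ltnW.
rewrite /B ler_pdivrMr // => h; lra.
Qed.

(** * The typicality code and its exponents *)

Definition bit (b : bool) : 'I_2 := if b then ord_max else ord0.

Lemma bitK b : (bit b == ord_max) = b.
Proof. by case: b. Qed.

(** The second bit is the conjunction of the verdicts on [x] and [y1], so Detector 2 has only to add
    its own test. The decisions are negated because [true] stands for the alternative. *)
Definition typicality_code {R : realType} {X Y1 Y2 : finType}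
    (P : {ffun ((X * Y1) * Y2)%type -> R}) (tau : R) (n : nat) : Defs.code X Y1 Y2 n :=
  @Code X Y1 Y2 n 2 2
    (fun x => bit (typical tau (push (@pX X Y1 Y2) P) n x))
    (fun m1 y => bit ((m1 == ord_max) && typical tau (push (@pY1 X Y1 Y2) P) n y))
    (fun m1 y => ~~ ((m1 == ord_max) && typical tau (push (@pY1 X Y1 Y2) P) n y))
    (fun _ m2 z => ~~ ((m2 == ord_max) && typical tau (push (@pY2 X Y1 Y2) P) n z)).

(** [K] will be a minimal divergence lowered by [O(tau)] and may be negative; the exponent 0 then
    comes from [b n <= 1]. *)
Lemma exponent_ge_of_types {R : realType} (b : nat -> R) (k : nat) (K th : R) :
  (forall n, (0 < n)%N -> b n <= (n.+1 ^ k)%:R * expR (- (n%:R * K))) ->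
  (forall n, b n <= 1) -> th <= Num.max K 0 -> exponent_ge b th.
Proof.
move=> hK h1; rewrite le_max => /orP[thK|th0] d d0; last first.
  exists 0%N => n _; apply: le_trans (h1 n) _; rewrite -[leLHS]expR0 ler_expR.
  rewrite -mulrN mulr_ge0 //; lra.
have [N hN] := poly_le_expR k d d0; exists N.+1 => n Nn.
apply: le_trans (hK n (leq_trans (ltn0Sn _) Nn)) _.
apply: le_trans (ler_wpM2r (expR_ge0 _) (hN n (ltnW Nn))) _.
rewrite -expRD ler_expR -mulrN -mulrDr -mulrN ler_wpM2l //; lra.
Qed.

Lemma rate_le_const {R : realType} (k : nat) : @rate_le R (fun=> k) 0.
Proof.
move=> d d0; exists (Num.bound (k%:R / d)) => n Nn.
apply: le_trans (expR_ge1Dx _); rewrite add0r.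
have x0 : 0 <= k%:R / d by rewrite divr_ge0 // ltW.
have : k%:R / d <= n%:R by apply: le_trans (ltW (archi_boundP x0)) _; rewrite ler_nat.
by rewrite ler_pdivrMr // => h; rewrite -[leLHS]add0r lerD.
Qed.

Section Achievability.
Context {R : realType} {X Y1 Y2 : finType}.
Notation T := ((X * Y1) * Y2)%type.
Variables (P Pb : {ffun T -> R}) (tau c : R).
Hypotheses (pmfP : is_pmf P) (pmfPb : is_pmf Pb) (Pb0 : forall t, 0 < Pb t).
Hypotheses (tau01 : 0 < tau < 1) (c0 : 0 < c) (cPb : forall t, c <= Pb t).

Let tau01' : 0 < tau <= 1. Proof. by case/andP: tau01 => -> /ltW. Qed.

Notation tX := (typical tau (push (@pX X Y1 Y2) P)).
Notation tY1 := (typical tau (push (@pY1 X Y1 Y2) P)).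
Notation tY2 := (typical tau (push (@pY2 X Y1 Y2) P)).
Notation tcode := (typicality_code P tau).

Lemma dec1_typicality n (s : {ffun 'I_n -> T}) :
  dec1 (tcode n) s = ~~ (tX n (xs s) && tY1 n (y1s s)).
Proof. by rewrite /dec1 /= bitK. Qed.

Lemma dec2_typicality n (s : {ffun 'I_n -> T}) :
  dec2 (tcode n) s = ~~ [&& tX n (xs s), tY1 n (y1s s) & tY2 n (y2s s)].
Proof. by rewrite /dec2 /= !bitK andbA. Qed.

Lemma atypical_prob {U : finType} (f : T -> U) (d : R) : 0 < d ->
  exists N, forall n, (N <= n)%N ->
    iid_mean P n (fun s => (~~ typical tau (push f P) n (map_seq f s))%:R) <= d.
Proof.
move=> d0; have [N hN] := typical_prob (push f P) tau d (is_pmf_push f P pmfP) tau01 d0.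
by exists N => n /hN; rewrite iid_mean_push.
Qed.

Lemma alpha_typicality (d : R) : 0 < d -> exists N, forall n, (N <= n)%N ->
  alpha1 P (tcode n) <= d /\ alpha2 P (tcode n) <= d.
Proof.
move=> d0; have d3 : 0 < d / 3 by rewrite divr_gt0.
have [N1 h1] := atypical_prob (@pX X Y1 Y2) _ d3.
have [N2 h2] := atypical_prob (@pY1 X Y1 Y2) _ d3.
have [N3 h3] := atypical_prob (@pY2 X Y1 Y2) _ d3.
exists (maxn N1 (maxn N2 N3)) => n; rewrite !geq_max => /and3P[n1 n2 n3].
have := lerD (lerD (h1 n n1) (h2 n n2)) (h3 n n3).
have -> : d / 3 + d / 3 + d / 3 = d by field.
rewrite -!iid_meanD => h; rewrite /alpha1 /alpha2 !seqprobE; split; apply: le_trans h.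
  apply: ler_iid_mean => // s; rewrite dec1_typicality -/(xs s) -/(y1s s) -/(y2s s).
  by case: (tX n _); case: (tY1 n _); case: (tY2 n _) => /=; lra.
apply: ler_iid_mean => // s; rewrite dec2_typicality -/(xs s) -/(y1s s) -/(y2s s).
by case: (tX n _); case: (tY1 n _); case: (tY2 n _) => /=; lra.
Qed.

(** The marginals of a joint type are the types of the component sequences, so on the acceptance
    region [theta2_star_le] applies to the joint type. *)
Lemma beta2_typicality n : (0 < n)%N -> beta2 Pb (tcode n) <=
  (n.+1 ^ #|{: T}|)%:R * expR (- (n%:R * (theta2_star P Pb + tau * ln c))).
Proof.
move=> n0; rewrite /beta2 seqprobE.
apply: (iid_prob_le_types Pb n (fun s => ~~ dec2 (tcode n) s)) => // s.
rewrite dec2_typicality negbK => /and3P[/forallP hX /forallP hY /forallP hZ].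
rewrite -lerBrDr; apply: (theta2_star_le P Pb tau c pmfP pmfPb Pb0 tau01' c0 cPb).
- exact: is_pmf_empirical.
- by move=> x; rewrite push_empirical.
- by move=> y; rewrite push_empirical.
- by move=> z; rewrite push_empirical.
Qed.

Lemma beta1_typicality n : (0 < n)%N -> beta1 Pb (tcode n) <=
  (n.+1 ^ #|{: X * Y1}|)%:R * expR (- (n%:R * (theta1_star P Pb + tau * ln c))).
Proof.
move=> n0; have [t0 _] := pmf_inhabited pmfP; rewrite /beta1 seqprobE.
(* The test of Detector 1 is moved to the pair alphabet, since types have to be counted there for
   the divergence of [XY1] laws to appear. *)
pose E (s : {ffun 'I_n -> X * Y1}) := tX n (map_seq fst s) && tY1 n (map_seq snd s).
have -> : iid_mean Pb n (fun s => (~~ dec1 (tcode n) s)%:R) =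
    iid_mean (push (@pXY1 X Y1 Y2) Pb) n (fun s => (E s)%:R).
  rewrite iid_mean_push; apply: eq_iid_mean => s; rewrite dec1_typicality negbK /= /E.
  by congr ((tX n _ && tY1 n _)%:R); apply/ffunP => i; rewrite !ffunE.
apply: iid_prob_le_types => // [u|s /andP[/forallP hX /forallP hY]].
  by rewrite -[u]/(pXY1 (u, pY2 t0)); exact: push_pXY1_gt0.
rewrite -lerBrDr; apply: (theta1_star_le P Pb tau c pmfP pmfPb Pb0 tau01' c0 cPb).
- exact: is_pmf_empirical.
- by move=> x; rewrite push_empirical.
- by move=> y; rewrite push_empirical.
Qed.

Lemma beta_le1 n (co : Defs.code X Y1 Y2 n) : beta1 Pb co <= 1 /\ beta2 Pb co <= 1.
Proof.
by rewrite /beta1 /beta2 !seqprobE; split; apply: (iid_mean_indicator_le1 Pb n (fun s => ~~ _)).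
Qed.

Lemma typicality_achievable (e1 e2 : R) (th : R * R) :
  0 <= e1 -> 0 <= e2 -> 0 <= th.1 -> 0 <= th.2 ->
  th.1 <= Num.max (theta1_star P Pb + tau * ln c) 0 ->
  th.2 <= Num.max (theta2_star P Pb + tau * ln c) 0 ->
  achievable P Pb 0 0 e1 e2 th.
Proof.
move=> e10 e20 th10 th20 h1 h2; split=> //; split=> //; exists tcode.
split; [|split; [|split; [|split]]].
- move=> d d0; have [N hN] := alpha_typicality d d0; exists N => n /hN [a1 _]; lra.
- move=> d d0; have [N hN] := alpha_typicality d d0; exists N => n /hN [_ a2]; lra.
- by apply: exponent_ge_of_types beta1_typicality _ h1 => n; have [] := beta_le1 n (tcode n).
- by apply: exponent_ge_of_types beta2_typicality _ h2 => n; have [] := beta_le1 n (tcode n).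
- by split; exact: rate_le_const.
Qed.

End Achievability.

(** * The region as a closure *)

Theorem theorem3 (R : realType) (X Y1 Y2 : finType)
    (P Pb : {ffun ((X * Y1) * Y2)%type -> R}) (e1 e2 : R) :
  is_pmf P -> is_pmf Pb ->
  (forall t, 0 < Pb t) ->
  0 < e1 < 1 -> 0 < e2 < 1 ->
  region P Pb 0 0 e1 e2 =
  [set th : R * R | 0 <= th.1 /\ 0 <= th.2 /\
     th.1 <= theta1_star P Pb /\ th.2 <= theta2_star P Pb].
Proof.
move=> pmfP pmfPb Pb0 /andP[e10 e11] /andP[e20 e21]; apply/seteqP; split=> th.
  move=> cl.
  (* Nonstrict bounds survive the closure: they hold up to every [e > 0] at a limit point. *)
  have near (e : R) : 0 < e -> exists a, [/\ achievable P Pb 0 0 e1 e2 a,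
      `|th.1 - a.1| < e & `|th.2 - a.2| < e].
    move=> e0; have [a [ach [/= b1 b2]]] := cl _ (nbhsx_ballx (th : R^o * R^o) e e0).
    by exists a; split.
  have bounds (e : R) : 0 < e -> [/\ - e <= th.1, - e <= th.2,
      th.1 <= theta1_star P Pb + e & th.2 <= theta2_star P Pb + e].
    move=> e0; have [a [ach]] := near e e0; rewrite !ltr_norml => /andP[? ?] /andP[? ?].
    have [? ?] := achievable_le_theta_star P Pb e1 e2 a pmfP pmfPb Pb0 e11 e21 ach.
    have [? [? _]] := ach; split; lra.
  split; [|split; [|split]]; apply/ler_addgt0Pr => e /bounds [] *; lra.
move=> [th10 [th20 [th1 th2]]] B /nbhs_ballP[e /= e0 eB].
have [c /andP[c0 c1] cPb] := pos_lower_bound Pb0.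
have lnc : 0 <= - ln c by rewrite oppr_ge0 ln_le0.
pose d := e / 2; have d0 : 0 < d by rewrite divr_gt0.
have D0 : 0 < d + 1 - ln c by lra.
(* Chosen so that [0 < tau < 1] and the divergence loss [- tau * ln c] is at most [d]. *)
pose tau := d / (d + 1 - ln c).
have tau01 : 0 < tau < 1 by rewrite divr_gt0 //= ltr_pdivrMr // mul1r; lra.
have tauc : - d <= tau * ln c.
  rewrite -[leRHS]opprK lerN2 -mulrN mulrAC ler_pdivrMr // ler_wpM2l //; lra.
(* Lowering by [d] pays for the loss due to [tau]; truncation at 0 keeps the pair nonnegative, and
   each coordinate moves by at most [d < e]. *)
exists (Num.max (th.1 - d) 0, Num.max (th.2 - d) 0); split.
  have shift (x y : R) : x <= y -> Num.max (x - d) 0 <= Num.max (y + tau * ln c) 0.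
    move=> xy; rewrite ge_max !le_max lexx orbT andbT; apply/orP; left; lra.
  have max0 (x : R) : 0 <= Num.max x 0 by rewrite le_max lexx orbT.
  exact: (typicality_achievable P Pb tau c pmfP pmfPb Pb0 tau01 c0 cPb e1 e2
    (Num.max (th.1 - d) 0, Num.max (th.2 - d) 0) (ltW e10) (ltW e20) (max0 _) (max0 _)
    (shift _ _ th1) (shift _ _ th2)).
have near (x : R) : 0 <= x -> `|x - Num.max (x - d) 0| < e.
  move=> x0; have ed : e = d + d by rewrite /d -splitr.
  by rewrite ltr_norml; case: (leP (x - d) 0) => h; apply/andP; split; lra.
by apply: eB; split; exact: near.
Qed.
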